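(* Let $p$ and $q$ be forms over $F$ of dimension at least two. The following are equivalent: (i) $q_{F(p)}$ is hyperbolic; (ii) $H_K(p)\subseteq G_K(q)$ for all field extensions $K/F$; (iii) the form $q\perp -xq$ over $L=F(\!(x)\!)$ is hyperbolic over the function field $L(p\perp -xp)$. Furthermore, if $1\in D_F(p)$, then (i)–(iii) are also equivalent to each of: (iv) $D_K(p)\subseteq G_K(q)$ for all field extensions $K/F$; (v) the form $q\perp -xq$ over $L=F(\!(x)\!)$ is hyperbolic over $L(p\perp\langle -x\rangle)$.
   Context: Throughout, $F$ is a field of characteristic different from $2$. A ''form'' means a non-degenerate quadratic form of positive dimension; $\langle a_1,\ldots,a_n\rangle$ denotes a diagonal form, $\perp$, $\otimes$ orthogonal sum and tensor product, $\simeq$ isometry, $aq=\langle a\rangle\otimes q$. For an extension $K/F$, $q_K$ is the scalar extension. A form is isotropic if it represents $0$ non-trivially, and hyperbolic if its Witt index equals half its dimension. $D_K(q)$ is the set of elements of $K^\times$ represented by $q_K$; $G_K(q)=\{a\in K^\times\mid aq_K\simeq q_K\}$; $H_K(q)=\{a\in K^\times\mid \langle1,-a\rangle\otimes q\text{ is isotropic over }K\}$. $F(\!(x)\!)$ is the Laurent series field in $x$ over $F$, and forms over $F$ are viewed over it via $F\subseteq F(\!(x)\!)$. Function field: for a form $p$ over a field $E$ (char $\neq2$) with $\dim p=n\ge 2$ and $p\not\simeq\langle1,-1\rangle$, $E(p)$ is the fraction field of $E[X_1,\ldots,X_n]/(p(X_1,\ldots,X_n))$; by convention $E(p)=E$ if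 $\dim p=1$ or $p\simeq\langle1,-1\rangle$. *)

(* Defs.v *)
From HB Require Import structures.
From mathcomp Require Import all_boot all_order all_algebra.
From mathcomp Require Import mpoly.
Set Implicit Arguments. Unset Strict Implicit. Unset Printing Implicit Defensive.
Import Order.TTheory GRing.Theory.
Local Open Scope ring_scope.

(* Quadratic forms (char <> 2) are represented by their symmetric Gram
   matrices: q(v) = v A v^T. *)
Section Forms.
Variable E : fieldType.

Definition qf n (A : 'M[E]_n) (v : 'rV[E]_n) : E := (v *m A *m v^T) 0 0.

Definition is_form n (A : 'M[E]_n) : Prop := (0 < n)%N /\ A^T = A /\ \det A != 0.

Definition oplus m n (A : 'M[E]_m) (B : 'M[E]_n) : 'M[E]_(m + n) :=
  block_mx A 0 0 B.

Definition isometric m n (A : 'M[E]_m) (B : 'M[E]_n) : Prop :=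
  m = n /\ exists P : 'M[E]_(m, n), \rank P = m /\ P^T *m A *m P = B.

Definition hplane : 'M[E]_2 := diag_mx (\row_(i < 2) (if i == ord0 then 1 else -1)).

Definition isotropic n (A : 'M[E]_n) : Prop :=
  exists v : 'rV[E]_n, v != 0 /\ qf A v = 0.

(* totally isotropic subspaces are row spaces of full-row-rank matrices W
   with W A W^T = 0; the Witt index is the maximal dimension of such. *)
Definition witt_index_is n (A : 'M[E]_n) (w : nat) : Prop :=
  (exists W : 'M[E]_(w, n), \rank W = w /\ W *m A *m W^T = 0) /\
  (forall k (W : 'M[E]_(k, n)), \rank W = k -> W *m A *m W^T = 0 -> (k <= w)%N).

Definition hyperbolic n (A : 'M[E]_n) : Prop :=
  exists w, witt_index_is A w /\ (2 * w)%N = n.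

Definition inD n (A : 'M[E]_n) (a : E) : Prop :=
  a != 0 /\ exists v, qf A v = a.
Definition inG n (A : 'M[E]_n) (a : E) : Prop :=
  a != 0 /\ isometric (a *: A) A.
(* <1,-a> (x) q  =  q _|_ (-a) q *)
Definition inH n (A : 'M[E]_n) (a : E) : Prop :=
  a != 0 /\ isotropic (oplus A ((- a) *: A)).

Definition qpoly n (A : 'M[E]_n) : {mpoly E[n]} :=
  \sum_(i < n) \sum_(j < n) A i j *: ('X_i * 'X_j).
End Forms.

(* (K, g) is the function field E(p): if dim p = 1 or p ~ <1,-1>, g is an
   isomorphism E ~ K; otherwise K is (isomorphic over E to) the fraction field
   of E[X_1..X_n]/(p): there are x_1..x_n in K such that the kernel of
   E[X] -> K, X_i |-> x_i is exactly the ideal (p), and K is generated as a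
   field by the image. *)
Definition is_function_field (E : fieldType) n (A : 'M[E]_n)
    (K : fieldType) (g : {rmorphism E -> K}) : Prop :=
  ((n = 1%N \/ isometric A (hplane E)) -> bijective g) /\
  (~ (n = 1%N \/ isometric A (hplane E)) -> exists x : 'I_n -> K,
    [/\ mmap g x (qpoly A) = 0,
        (forall h : {mpoly E[n]}, mmap g x h = 0 -> exists r, h = r * qpoly A)
      & (forall y : K, exists h1 h2 : {mpoly E[n]},
            mmap g x h2 != 0 /\ y = mmap g x h1 / mmap g x h2)]).

Definition ps_add (E : fieldType) (a b : nat -> E) : nat -> E := fun k => a k + b k.
Definition ps_mul (E : fieldType) (a b : nat -> E) : nat -> E :=
  fun k => \sum_(i < k.+1) a i * b (k - i)%N.
Definition ps_const (E : fieldType) (c : E) : nat -> E :=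
  fun k => if k == 0%N then c else 0.
Definition ps_X (E : fieldType) : nat -> E := fun k => if k == 1%N then 1 else 0.

(* (L, f, x) is the Laurent series field F((x)) = F[[x]][1/x]: F[[x]] embeds
   into L as a ring (constants via f, X |-> x), and every element of L is
   s / x^k with s a power series. *)
Definition is_laurent (F L : fieldType) (f : {rmorphism F -> L}) (x : L) : Prop :=
  exists phi : (nat -> F) -> L,
    [/\ injective phi,
        (forall a b, phi (ps_add a b) = phi a + phi b /\
                     phi (ps_mul a b) = phi a * phi b),
        (forall c, phi (ps_const c) = f c),
        phi (ps_X F) = x
      & (forall y : L, exists (a : nat -> F) (k : nat), y = phi a / x ^+ k)].

(* Main.v *)
(** All five conditions are compared with a sixth one, (i'): q_E is hyperbolic
    for every extension E/F over which p is isotropic.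

    (i) gives (i'): if p_E is isotropic with zero v, then the second zero
    x = T - (p(T) / 2 b(v,T)) v of p on the line through a generic vector T in
    direction v is a generic point of p over F (for dim p = 2 with p anisotropic
    one takes x = T v, T a variable). Hence F(p) embeds in a rational function
    field over E, and anisotropic forms over E stay anisotropic there.

    (i') gives (ii): if a = p(u) / p(v), let d = b(u,v)^2 - p(u) p(v). Then p is
    isotropic over K(sqrt d), so q is hyperbolic there, so every norm from
    K(sqrt d) is a similarity factor of q; p(u) p(v) = b(u,v)^2 - d is one.

    Each of (ii)-(v) gives (i'): over E((t)) it makes q _|_ -tq hyperbolic, and
    if q_E is anisotropic then so is q _|_ -tq over E((t)). *)

Require Import Defs.
From HB Require Import structures.
From mathcomp Require Import all_boot all_order all_algebra.
From mathcomp Require Import mpoly.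
From mathcomp Require Import boolp qpoly qfpoly ring zify.
Import GRing.Theory.
Local Open Scope ring_scope.
Set Implicit Arguments. Unset Strict Implicit. Unset Printing Implicit Defensive.
Import Order.TTheory.

(** * Metabolic forms and Witt splitting *)

Section Symmetric.
Variable E : fieldType.

(** Condition (i) speaks only of fields satisfying [is_function_field], so exploiting it over a
    given E requires producing such a field together with a map into an extension of E. It is taken
    as the subfield of E(T_1, ..., T_m) generated by the generic zero. The polynomials over F
    vanishing there must then be exactly the multiples of p, although the zero is defined over E.
    The field F((x)) inside E((t)) is obtained in the same way.

    Hyperbolicity is handled through Lagrangians, which any field map carries along. Descent follows
    one pattern: split off hyperbolic planes over the small field, cancel them over the large one,
    and note that an anisotropic form with a Lagrangian has dimension 0.

    The variable t serves as a generic similarity factor: if p_E is isotropic, t lies in both D(p)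
    and H(p) over E((t)), so (ii) and (iv) make it a similarity factor of q, while (iii) and (v)
    reach q _|_ -tq by sending x to t. *)

Definition nondeg n (A : 'M[E]_n) := A^T = A /\ A \in unitmx.

Definition metabolic n (A : 'M[E]_n) := exists k (W : 'M[E]_(k, n)),
  [/\ row_free W, W *m A *m W^T = 0 & (2 * k)%N = n].

Lemma is_form_nondeg n (A : 'M[E]_n) : is_form A -> nondeg A.
Proof. by case=> _ [As dA]; split; rewrite // unitmxE unitfE. Qed.

Lemma mxrank_unit_mul_tr n (A : 'M[E]_n) k (W : 'M_(k, n)) :
  A \in unitmx -> \rank (A *m W^T) = \rank W.
Proof.
move=> Au; rewrite -[LHS]mxrank_tr trmx_mul trmxK mxrankMfree //.
by rewrite row_free_unit unitmx_tr.
Qed.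

Lemma rank_totally_isotropic n (A : 'M[E]_n) k (W : 'M_(k, n)) :
  A \in unitmx -> W *m A *m W^T = 0 -> (2 * \rank W <= n)%N.
Proof.
move=> Au; rewrite -mulmxA => /eqP; rewrite -sub_kermx => /mxrankS.
by rewrite mxrank_ker mxrank_unit_mul_tr // => rW; have := rank_leq_col W; lia.
Qed.

(** Allows dependent rows: a Lagrangian found as an image has no distinguished basis, so a row basis
    is taken. *)
Lemma metabolic_rank n (A : 'M[E]_n) k (W : 'M_(k, n)) :
  W *m A *m W^T = 0 -> (2 * \rank W)%N = n -> metabolic A.
Proof.
move=> W0 rW; exists (\rank W), (row_base W); split=> //.
  exact: row_base_free.
have /submxP[D ->] : (row_base W <= W)%MS by rewrite eq_row_base.
by rewrite trmx_mul !mulmxA -2!(mulmxA D) W0 mulmx0 mul0mx.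
Qed.

(** A totally isotropic space has at most half the dimension, so a Lagrangian meets the maximality
    clause of the Witt index automatically. *)
Lemma hyperbolicP n (A : 'M[E]_n) : A \in unitmx -> hyperbolic A <-> metabolic A.
Proof.
move=> Au; split=> [[w [[[W [rW W0]] _] wn]]|[k [W [/eqP rW W0 kn]]]].
  by exists w, W; split=> //; apply/eqP.
exists k; split=> //; split=> [|k' W' rW' /(rank_totally_isotropic Au)].
  by exists W.
by rewrite rW' -kn leq_mul2l.
Qed.

Lemma isometric_congr n (A : 'M[E]_n) (S : 'M_n) :
  S \in unitmx -> isometric A (S *m A *m S^T).
Proof.
move=> Su; split=> //; exists S^T; split; last by rewrite trmxK.
by rewrite mxrank_tr mxrank_unit.
Qed.

Lemma unitmx_congr p n (A : 'M[E]_n) (T : 'M_(p, n)) :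
  p = n -> row_free T -> A \in unitmx -> T *m A *m T^T \in unitmx.
Proof.
move=> pn; case: n / pn A T => A T; rewrite row_free_unit => Tu Au.
by rewrite !unitmx_mul Tu Au unitmx_tr.
Qed.

Lemma isometricP n (A B : 'M[E]_n) :
  isometric A B <-> exists2 S : 'M_n, S \in unitmx & S *m A *m S^T = B.
Proof.
split=> [[_ [S [rS SB]]]|[S Su <-]]; last exact: isometric_congr.
exists S^T; last by rewrite trmxK.
by rewrite unitmx_tr -row_free_unit /row_free rS.
Qed.

Lemma isometric_sym n (A B : 'M[E]_n) : isometric A B -> isometric B A.
Proof.
move=> /isometricP[S Su SB]; apply/isometricP.
exists (invmx S); first by rewrite unitmx_inv.
by rewrite -SB trmx_inv !mulmxA mulVmx // mul1mx mulmxK ?unitmx_tr.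
Qed.

Lemma isometric_trans n (A B C : 'M[E]_n) :
  isometric A B -> isometric B C -> isometric A C.
Proof.
move=> /isometricP[S Su SB] /isometricP[T Tu TC].
apply/isometricP; exists (T *m S); first by rewrite unitmx_mul Tu.
by rewrite -TC -SB trmx_mul !mulmxA.
Qed.

Lemma isometric_scale n (A B : 'M[E]_n) a :
  isometric A B -> isometric (a *: A) (a *: B).
Proof.
move=> /isometricP[S Su SB].
by apply/isometricP; exists S; rewrite // -SB -scalemxAr -scalemxAl.
Qed.

Lemma isometric_oplus m n (A C : 'M[E]_m) (B D : 'M_n) :
  isometric A C -> isometric B D -> isometric (oplus A B) (oplus C D).
Proof.
move=> /isometricP[S Su SC] /isometricP[T Tu TD].
apply/isometricP; exists (block_mx S 0 0 T).
  by rewrite unitmxE det_ublock unitrM -!unitmxE Su.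
rewrite /oplus tr_block_mx !mulmx_block !trmx0.
by rewrite !(mulmx0, mul0mx, addr0, add0r) SC TD.
Qed.

Lemma oplus_scale m n (A : 'M[E]_m) (B : 'M_n) a :
  a *: oplus A B = oplus (a *: A) (a *: B).
Proof. by rewrite /oplus scale_block_mx !scaler0. Qed.

Lemma oplus_congr m n p q (A : 'M[E]_m) (B : 'M_n) (X : 'M_(p, m)) (Y : 'M_(q, n)) :
  block_mx X 0 0 Y *m oplus A B *m (block_mx X 0 0 Y)^T
  = oplus (X *m A *m X^T) (Y *m B *m Y^T).
Proof.
rewrite /oplus tr_block_mx !mulmx_block !trmx0.
by rewrite !(mulmx0, mul0mx, addr0, add0r).
Qed.

Lemma unitmx_oplus m n (A : 'M[E]_m) (B : 'M_n) :
  (oplus A B \in unitmx) = (A \in unitmx) && (B \in unitmx).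
Proof. by rewrite !unitmxE det_ublock unitrM. Qed.

Lemma nondeg_oplus m n (A : 'M[E]_m) (B : 'M_n) :
  nondeg A -> nondeg B -> nondeg (oplus A B).
Proof.
move=> [As Au] [Bs Bu]; split; last by rewrite unitmx_oplus Au.
by rewrite /oplus tr_block_mx As Bs !trmx0.
Qed.

Lemma nondeg_scale n (A : 'M[E]_n) a : a != 0 -> nondeg A -> nondeg (a *: A).
Proof.
by move=> a0 [As Au]; split; rewrite ?linearZ /= ?As // unitmxZ ?unitfE.
Qed.

Lemma nondeg_scalar1 (a : E) : a != 0 -> nondeg (a%:M : 'M_1).
Proof. by move=> a0; split; rewrite ?tr_scalar_mx // unitmxE det_scalar1 unitfE. Qed.

Lemma qf_scale n (A : 'M[E]_n) a v : qf A (a *: v) = a ^+ 2 * qf A v.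
Proof. by rewrite /qf linearZ /= -!scalemxAl -scalemxAr !mxE mulrA. Qed.

Lemma qf_oplus m n (A : 'M[E]_m) (B : 'M_n) u v :
  qf (oplus A B) (row_mx u v) = qf A u + qf B v.
Proof.
rewrite /qf /oplus tr_row_mx mul_row_block !mulmx0 addr0 add0r.
by rewrite mul_row_col !mxE.
Qed.

Lemma qfZ n (A : 'M[E]_n) a v : qf (a *: A) v = a * qf A v.
Proof. by rewrite /qf -scalemxAr -scalemxAl mxE. Qed.

Lemma bil_sym n (A : 'M[E]_n) (u v : 'rV_n) :
  A^T = A -> (u *m A *m v^T) 0 0 = (v *m A *m u^T) 0 0.
Proof.
move=> As; have -> : u *m A *m v^T = (v *m A *m u^T)^T.
  by rewrite !trmx_mul trmxK As mulmxA.
by rewrite mxE.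
Qed.

Lemma qfD n (A : 'M[E]_n) u v a : A^T = A ->
  qf A (u + a *: v) = qf A u + 2%:R * a * (u *m A *m v^T) 0 0 + a ^+ 2 * qf A v.
Proof.
move=> As; have := bil_sym u v As.
rewrite /qf linearD linearZ /= !mulmxDl !mulmxDr -!scalemxAl -!scalemxAr !mxE => <-.
by ring.
Qed.

Lemma mx11E (M : 'M[E]_1) (a : E) : M 0 0 = a -> M = a%:M.
Proof. by move=> <-; exact: mx11_scalar. Qed.

Lemma isotropic_mx n (A : 'M[E]_n) v : qf A v = 0 -> v *m A *m v^T = 0.
Proof. by move=> /mx11E ->; rewrite raddf0. Qed.

(* If W is a Lagrangian of A and U one of Y A Y^T, then the projection of
   W :&: U^_|_ along Y has at least half the dimension of X A X^T. *)
Lemma metabolic_cancel n p r (A : 'M[E]_n) (X : 'M_(p, n)) (Y : 'M_(r, n)) :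
  nondeg A -> (p + r)%N = n -> row_free (col_mx X Y) ->
  X *m A *m Y^T = 0 -> metabolic A -> metabolic (Y *m A *m Y^T) ->
  metabolic (X *m A *m X^T).
Proof.
move=> [As Au] prn XYfree XY0 [k [W [Wfree W0 kn]]] [u [U [Ufree U0 ur]]].
have YX0 : Y *m A *m X^T = 0.
  by apply: trmx_inj; rewrite !trmx_mul trmxK As mulmxA XY0 trmx0.
set R := Y *m A *m Y^T in U0.
have Rs : R^T = R by rewrite /R !trmx_mul trmxK As mulmxA.
have diag : col_mx X Y *m A *m (col_mx X Y)^T = oplus (X *m A *m X^T) R.
  rewrite tr_col_mx mul_col_mx mul_col_row -/R XY0 YX0; by [].
have [Xu Ru] : X *m A *m X^T \in unitmx /\ R \in unitmx.
  by apply/andP; rewrite -unitmx_oplus -diag unitmx_congr.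
have /submxP[c Wc] : (W <= col_mx X Y)%MS.
  by apply: submx_full; rewrite /row_full (eqP XYfree) prn.
rewrite -[c]hsubmxK in Wc; set a := lsubmx c in Wc; set b := rsubmx c in Wc.
rewrite mul_row_col in Wc.
have Wab : a *m (X *m A *m X^T) *m a^T = - (b *m R *m b^T).
  have c1 : (a *m X) *m A *m (b *m Y)^T = 0.
    by rewrite trmx_mul !mulmxA -2!(mulmxA a) XY0 mulmx0 mul0mx.
  have c2 : (b *m Y) *m A *m (a *m X)^T = 0.
    by rewrite trmx_mul !mulmxA -2!(mulmxA b) YX0 mulmx0 mul0mx.
  apply/eqP; rewrite -addr_eq0 -W0 Wc linearD /= !mulmxDl !mulmxDr c1 c2.
  by rewrite addr0 add0r !trmx_mul !mulmxA.
(* [Z] collects the coefficient rows [z] for which the [Y]-component [z *m b] of [z *m W] is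
   orthogonal to [U]. As [U] is its own orthogonal, that component lies in [U], hence is isotropic,
   and so is the [X]-component [z *m a]. *)
clearbody R; set G := b *m R *m U^T; set Z := kermx G.
have rG : \rank (U *m R *m b^T) = \rank G.
  by rewrite -[RHS]mxrank_tr !trmx_mul trmxK Rs mulmxA.
have ZU : (Z *m b <= U)%MS.
  have UK : (U <= kermx (R *m U^T))%MS by rewrite sub_kermx mulmxA U0.
  have KU : (kermx (R *m U^T) <= U)%MS.
    rewrite -(geq_leqif (mxrank_leqif_sup UK)) mxrank_ker.
    by rewrite mxrank_unit_mul_tr // (eqP Ufree) -ur; lia.
  apply: submx_trans KU; rewrite sub_kermx.
  have -> : Z *m b *m (R *m U^T) = Z *m G by rewrite !mulmxA.
  by rewrite mulmx_ker.
have /submxP[D ZD] := ZU.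
have Zti : (Z *m a) *m (X *m A *m X^T) *m (Z *m a)^T = 0.
  have -> : (Z *m a) *m (X *m A *m X^T) *m (Z *m a)^T
     = Z *m (a *m (X *m A *m X^T) *m a^T) *m Z^T by rewrite trmx_mul !mulmxA.
  have -> : Z *m (a *m (X *m A *m X^T) *m a^T) *m Z^T = - (Z *m b *m R *m (Z *m b)^T).
    by rewrite Wab mulmxN mulNmx (trmx_mul Z b) !mulmxA.
  by rewrite ZD trmx_mul !mulmxA -2!(mulmxA D) U0 mulmx0 mul0mx oppr0.
apply: (metabolic_rank Zti).
(* [N] describes the vectors of [W] lost by projecting to [X]. Their [Y]-components lie in [U] and
   are orthogonal to all rows of [b], so they span at most [u - \rank G] dimensions. What remains is
   at least [(k - \rank G) - (u - \rank G) = k - u], half of [p]. *)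
set N := (Z :&: kermx a)%MS.
have Na : N *m a = 0 by apply/eqP; rewrite -sub_kermx capmxSr.
have NbU : (N *m b <= U)%MS.
  by apply: submx_trans ZU; apply: submxMr; rewrite capmxSl.
have /submxP[D' ND'] := NbU.
have rN : (\rank N <= \rank (N *m b))%N.
  rewrite -(mxrankMfree N Wfree) Wc mulmxDr !mulmxA Na mul0mx add0r.
  exact: mxrankM_maxl.
have D'0 : D' *m (U *m R *m b^T) = 0.
  have -> : D' *m (U *m R *m b^T) = N *m (b *m R *m b^T) by rewrite !mulmxA ND'.
  by apply/eqP; rewrite -oppr_eq0 -mulmxN -Wab !mulmxA Na !mul0mx.
have rD' : (\rank D' <= u - \rank G)%N.
  by rewrite -rG -mxrank_ker; apply: mxrankS; rewrite sub_kermx D'0.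
have rND' : (\rank (N *m b) <= \rank D')%N by rewrite ND' mxrankM_maxl.
have := mxrank_mul_ker Z a; rewrite -/N mxrank_ker => rZ.
have := rank_totally_isotropic Xu Zti.
have := rank_leq_row G.
have := rank_leq_col G.
by lia.
Qed.

End Symmetric.

Section WittSplitting.
Variable E : fieldType.
Hypothesis two_neq0 : 2%:R != 0 :> E.

(** The hyperbolic plane in a basis of isotropic vectors; its isometry with the diagonal [hplane]
    uses 1/2. The size [1 + 1] keeps it a block matrix. *)
Definition hmx : 'M[E]_(1 + 1) := block_mx 0 1%:M 1%:M 0.

Lemma hmx_nondeg : nondeg hmx.
Proof.
split; first by rewrite /hmx tr_block_mx !trmx0 !trmx1.
suff /mulmx1_unit[] : hmx *m hmx = 1%:M by [].
by rewrite mulmx_block !(mulmx0, mul0mx, mulmx1, addr0, add0r) -scalar_mx_block.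
Qed.

Lemma metabolic_hmx : metabolic hmx.
Proof.
exists 1%N, (row_mx 1%:M 0); split=> //.
  by apply: inj_row_free => v /(congr1 lsubmx); rewrite mul_mx_row row_mxKl mulmx1 linear0.
by rewrite mul_row_block tr_row_mx mul_row_col !(mulmx0, mul0mx, addr0, add0r, mulmx1, trmx0).
Qed.

Lemma qf_hmx (a b : E) : qf hmx (row_mx a%:M b%:M) = 2%:R * a * b.
Proof.
rewrite /qf mul_row_block tr_row_mx mul_row_col !tr_scalar_mx !(mulmx0, mulmx1) addr0 add0r.
by rewrite -!scalar_mxM !mxE /= !mulr1n; ring.
Qed.

Lemma dual_vector n (A : 'M[E]_n) (v : 'rV_n) : A \in unitmx -> v != 0 ->
  exists w : 'rV_n, (v *m A *m w^T) 0 0 = 1.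
Proof.
move=> Au v0; have vA0 : v *m A != 0.
  by apply: contraNneq v0 => vA; rewrite -[v](mulmxK Au) vA mul0mx.
have [i vAi] : exists i, (v *m A) 0 i != 0.
  apply/existsP; apply: contraNT vA0; rewrite negb_exists => /forallP h.
  by apply/eqP/rowP => i; have := h i; rewrite negbK => /eqP ->; rewrite mxE.
exists (((v *m A) 0 i)^-1 *: delta_mx 0 i); move: (v *m A) vAi => u ui.
by rewrite linearZ /= trmx_delta -scalemxAr -colE !mxE mulVf.
Qed.

Lemma hyperbolic_pair n (A : 'M[E]_n) : nondeg A -> isotropic A ->
  exists2 Y : 'M_(1 + 1, n), Y *m A *m Y^T = hmx & row_free Y.
Proof.
move=> [As Au] [v [v0 qv]].
have [w0 vw0] := dual_vector Au v0.
(* Since q(v) = 0 and b(v, w0) = 1, q(w0 + c v) = q(w0) + 2c, which vanishes for c = -q(w0)/2. *)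
pose w := w0 + (- (qf A w0 / 2%:R)) *: v.
have qw : qf A w = 0.
  rewrite qfD // qv mulr0 addr0 bil_sym // vw0; field.
  exact: two_neq0.
have vw : (v *m A *m w^T) 0 0 = 1.
  rewrite /w linearD linearZ /= mulmxDr -!scalemxAr (isotropic_mx qv) scaler0.
  by rewrite addr0.
have wv : (w *m A *m v^T) 0 0 = 1 by rewrite bil_sym.
exists (col_mx v w).
  rewrite mul_col_mx tr_col_mx mul_col_row /hmx.
  by rewrite (isotropic_mx qv) (isotropic_mx qw) (mx11E vw) (mx11E wv).
have Yh : col_mx v w *m (A *m (col_mx v w)^T) = hmx.
  rewrite mulmxA mul_col_mx tr_col_mx mul_col_row /hmx.
  by rewrite (isotropic_mx qv) (isotropic_mx qw) (mx11E vw) (mx11E wv).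
apply: inj_row_free => z zY; rewrite -[z](mulmxK (proj2 hmx_nondeg)).
by rewrite -Yh (mulmxA z) zY !mul0mx.
Qed.

Lemma witt_split n (A : 'M[E]_n) : nondeg A -> isotropic A ->
  exists k (X : 'M_(k, n)) (Y : 'M_(1 + 1, n)),
  [/\ (k + (1 + 1))%N = n, row_free (col_mx X Y), X *m A *m Y^T = 0
    & Y *m A *m Y^T = hmx].
Proof.
move=> nA iA; have [As Au] := nA; have [Y Yh Yfree] := hyperbolic_pair nA iA.
exists _, (row_base (kermx (A *m Y^T))), Y; split=> //.
- rewrite mxrank_ker mxrank_unit_mul_tr // (eqP Yfree) subnK //.
  by rewrite -(eqP Yfree) rank_leq_col.
- apply: inj_row_free => z; rewrite -[z]hsubmxK mul_row_col => z0.
  have XY0 : row_base (kermx (A *m Y^T)) *m (A *m Y^T) = 0.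
    by apply/eqP; rewrite -sub_kermx eq_row_base.
  have z2 : rsubmx z = 0.
    have : (lsubmx z *m row_base (kermx (A *m Y^T)) + rsubmx z *m Y) *m (A *m Y^T) = 0.
      by rewrite z0 mul0mx.
    rewrite mulmxDl -mulmxA XY0 mulmx0 add0r -mulmxA (mulmxA Y) Yh => zh.
    by rewrite -[rsubmx z](mulmxK (proj2 hmx_nondeg)) zh mul0mx.
  move: z0; rewrite z2 mul0mx addr0 => z0.
  suff -> : lsubmx z = 0 by rewrite row_mx0.
  by apply: (row_free_inj (row_base_free _)); rewrite z0 mul0mx.
by rewrite -mulmxA; apply/eqP; rewrite -sub_kermx eq_row_base.
Qed.

Lemma nondeg_congr p n (A : 'M[E]_n) (T : 'M_(p, n)) :
  p = n -> row_free T -> nondeg A -> nondeg (T *m A *m T^T).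
Proof.
move=> pn Tf [As Au]; split; last exact: unitmx_congr.
by rewrite !trmx_mul trmxK As mulmxA.
Qed.

Lemma split_congr k r n (A : 'M[E]_n) (X : 'M_(k, n)) (Y : 'M_(r, n)) :
  A^T = A -> X *m A *m Y^T = 0 ->
  col_mx X Y *m A *m (col_mx X Y)^T = oplus (X *m A *m X^T) (Y *m A *m Y^T).
Proof.
move=> As XY0; have YX0 : Y *m A *m X^T = 0.
  by apply: trmx_inj; rewrite !trmx_mul trmxK As mulmxA XY0 trmx0.
by rewrite tr_col_mx mul_col_mx mul_col_row XY0 YX0.
Qed.

(** Reduces each later statement to anisotropic forms, dimension 0 included. The complement of the
    plane is given by rows [X] inside the ambient space, with [k + (1 + 1) = n] as a mere equation,
    so that [A] is never cast to another size. *)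
Lemma witt_ind (P : forall n, 'M[E]_n -> Prop) :
  (forall n (A : 'M_n), nondeg A -> ~ isotropic A -> P n A) ->
  (forall k n (A : 'M_n) (X : 'M_(k, n)) (Y : 'M_(1 + 1, n)),
     nondeg A -> nondeg (X *m A *m X^T) ->
     (k + (1 + 1))%N = n -> row_free (col_mx X Y) -> X *m A *m Y^T = 0 ->
     Y *m A *m Y^T = hmx -> P k (X *m A *m X^T) -> P n A) ->
  forall n (A : 'M_n), nondeg A -> P n A.
Proof.
move=> Paniso Psplit n; elim/ltn_ind: n => n IHn A nA.
have [iA|] := pselect (isotropic A); last exact: Paniso.
have [k [X [Y [kn XYf XY0 Yh]]]] := witt_split nA iA.
have nX : nondeg (X *m A *m X^T).
  have := nondeg_congr kn XYf nA; rewrite (split_congr (proj1 nA) XY0).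
  move=> [_]; rewrite unitmx_oplus => /andP[Xu _]; split=> //.
  by rewrite !trmx_mul trmxK (proj1 nA) mulmxA.
apply: (Psplit k n A X Y) => //; apply: IHn => //.
by rewrite -kn addnC.
Qed.

Lemma isometric_split k n (A : 'M[E]_n) (X : 'M_(k, n)) (Y : 'M_(1 + 1, n)) :
  nondeg A -> (k + (1 + 1))%N = n -> row_free (col_mx X Y) ->
  X *m A *m Y^T = 0 -> Y *m A *m Y^T = hmx ->
  isometric A (oplus (X *m A *m X^T) hmx).
Proof.
move=> [As _] kn XYf XY0 Yh; split; first by rewrite kn.
exists (col_mx X Y)^T; rewrite mxrank_tr trmxK (split_congr As XY0) Yh.
by split=> //; rewrite (eqP XYf).
Qed.

(** Multiplying one of the two isotropic basis vectors by [a] multiplies the whole Gram matrix by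
    [a]. *)
Lemma inG_hmx a : a != 0 -> inG hmx a.
Proof.
move=> a0; split=> //; apply: isometric_sym; apply/isometricP.
exists (block_mx a%:M 0 0 1%:M).
  by rewrite unitmxE det_ublock det_scalar1 det1 mulr1 unitfE.
rewrite /hmx tr_block_mx !mulmx_block !trmx0 tr_scalar_mx trmx1 scale_block_mx.
rewrite !(mulmx0, mul0mx, addr0, add0r, mulmx1, mul1mx, scaler0).
by rewrite scale_scalar_mx mulr1.
Qed.

Lemma inG_isometric n (A B : 'M[E]_n) a : isometric A B -> inG B a -> inG A a.
Proof.
move=> AB [a0 aB]; split=> //; apply: isometric_trans (isometric_scale a AB) _.
by apply: isometric_trans aB _; apply: isometric_sym.
Qed.

Lemma inG_oplus m n (A : 'M[E]_m) (B : 'M_n) a :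
  inG A a -> inG B a -> inG (oplus A B) a.
Proof.
by move=> [a0 aA] [_ aB]; split=> //; rewrite oplus_scale; apply: isometric_oplus.
Qed.

Lemma inG_split k n (A : 'M[E]_n) (X : 'M_(k, n)) (Y : 'M_(1 + 1, n)) a :
  nondeg A -> (k + (1 + 1))%N = n -> row_free (col_mx X Y) ->
  X *m A *m Y^T = 0 -> Y *m A *m Y^T = hmx ->
  inG (X *m A *m X^T) a -> inG A a.
Proof.
move=> nA kn XYf XY0 Yh Ga; have := isometric_split nA kn XYf XY0 Yh.
case: n / kn A X Y nA XYf XY0 Yh Ga => A X Y nA XYf XY0 Yh Ga.
move/inG_isometric; apply; apply: inG_oplus => //.
by apply: inG_hmx; case: Ga.
Qed.

(** The graph of an isometry between aq and q is a Lagrangian of q _|_ -aq. *)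
Lemma inG_metabolic n (A : 'M[E]_n) a :
  A^T = A -> inG A a -> metabolic (oplus A ((- a) *: A)).
Proof.
move=> As [a0 /isometricP[S Su SA]]; exists n, (row_mx 1%:M S); split=> //.
- by apply: inj_row_free => v /(congr1 lsubmx); rewrite mul_mx_row row_mxKl mulmx1 linear0.
- rewrite /oplus mul_row_block tr_row_mx mul_row_col.
  rewrite !(mulmx0, mul1mx, addr0, add0r, trmx1, mulmx1).
  by rewrite scaleNr mulmxN mulNmx SA subrr.
by rewrite mul2n addnn.
Qed.
End WittSplitting.

Section Metabolic.
Variable E : fieldType.

Lemma anisotropic_metabolic n (A : 'M[E]_n) : metabolic A -> ~ isotropic A -> n = 0%N.
Proof.
move=> [[|k] [W [Wf W0 kn]]] iA; first by rewrite -kn.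
exfalso; apply: iA.
exists (row 0 W); split.
  apply/eqP; rewrite rowE -[RHS](mul0mx _ W) => /(row_free_inj Wf) /rowP/(_ 0).
  by rewrite !mxE eqxx => /eqP; rewrite oner_eq0.
rewrite /qf rowE trmx_mul !mulmxA -2!(mulmxA (delta_mx _ _)) W0.
by rewrite mulmx0 mul0mx mxE.
Qed.

Lemma metabolic_dim0 n (A : 'M[E]_n) : n = 0%N -> metabolic A.
Proof.
case: n A => // A _.
by exists 0%N, 1%:M; split=> //; [rewrite row_free_unit unitmx1 | apply/matrixP => -[]].
Qed.

Lemma metabolic_isometric m n (A : 'M[E]_m) (B : 'M_n) :
  isometric A B -> metabolic A -> metabolic B.
Proof.
move=> i; have mn := proj1 i; case: n / mn B i => B /isometricP[S Su <-].
move=> [k [W [Wf W0 km]]]; exists k, (W *m invmx S); split=> //.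
  by rewrite /row_free mxrankMfree // row_free_unit unitmx_inv.
by rewrite trmx_mul trmx_inv !mulmxA mulmxKV // mulmxK ?unitmx_tr.
Qed.

Lemma metabolic_oplus m n (A : 'M[E]_m) (B : 'M_n) :
  metabolic A -> metabolic B -> metabolic (oplus A B).
Proof.
move=> [k [W [Wf W0 km]]] [l [U [Uf U0 ln]]].
exists (k + l)%N, (block_mx W 0 0 U); split; last by rewrite -km -ln mulnDr.
  apply: inj_row_free => z; rewrite -[z]hsubmxK mul_row_block !mulmx0 addr0 add0r => z0.
  have := congr1 lsubmx z0; have := congr1 rsubmx z0.
  rewrite row_mxKl row_mxKr !linear0 => z2 z1.
  suff [-> ->] : lsubmx z = 0 /\ rsubmx z = 0 by rewrite row_mx0.
  by split; [apply: (row_free_inj Wf) | apply: (row_free_inj Uf)]; rewrite mul0mx.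
by rewrite oplus_congr W0 U0 /oplus block_mx0.
Qed.

Lemma metabolic_scale n (A : 'M[E]_n) a : metabolic A -> metabolic (a *: A).
Proof.
move=> [k [W [Wf W0 kn]]]; exists k, W; split=> //.
by rewrite -scalemxAr -scalemxAl W0 scaler0.
Qed.

Lemma metabolic_split k n (A : 'M[E]_n) (X : 'M_(k, n)) (Y : 'M_(1 + 1, n)) :
  nondeg A -> (k + (1 + 1))%N = n -> row_free (col_mx X Y) ->
  X *m A *m Y^T = 0 -> Y *m A *m Y^T = hmx E ->
  metabolic (X *m A *m X^T) -> metabolic A.
Proof.
move=> nA kn XYf XY0 Yh mX; have := isometric_split nA kn XYf XY0 Yh.
case: n / kn A X Y nA XYf XY0 Yh mX => A X Y nA XYf XY0 Yh mX /isometric_sym i.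
by apply: metabolic_isometric i _; apply: metabolic_oplus mX (metabolic_hmx _).
Qed.
End Metabolic.

(** * Metabolic forms under field extension *)

Section BaseChange.
Variables (E K : fieldType) (g : {rmorphism E -> K}).
Local Notation "M ^g" := (map_mx g M) (at level 2, format "M ^g").

Lemma map_metabolic n (A : 'M_n) : metabolic A -> metabolic A^g.
Proof.
move=> [k [W [Wf W0 kn]]]; exists k, W^g; split=> //; first by rewrite row_free_map.
by rewrite matrix.map_trmx -!map_mxM W0 map_mx0.
Qed.

Lemma map_nondeg n (A : 'M_n) : nondeg A -> nondeg A^g.
Proof. by move=> [As Au]; split; rewrite ?map_unitmx // matrix.map_trmx As. Qed.

Lemma qf_map n (A : 'M_n) v : qf A^g v^g = g (qf A v).
Proof. by rewrite /qf matrix.map_trmx -!map_mxM mxE. Qed.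

Lemma map_isotropic n (A : 'M_n) : isotropic A -> isotropic A^g.
Proof.
move=> [v [v0 qv]]; exists v^g; split; last by rewrite qf_map qv rmorph0.
by rewrite map_mx_eq0.
Qed.

Lemma map_oplus m n (A : 'M_m) (B : 'M_n) : (oplus A B)^g = oplus A^g B^g.
Proof. by rewrite /oplus map_block_mx !map_mx0. Qed.

Lemma map_hmx : (hmx E)^g = hmx K.
Proof. by rewrite /hmx map_block_mx !map_mx0 map_scalar_mx rmorph1. Qed.

Hypothesis two_neq0 : 2%:R != 0 :> E.

(** A plane split off over [E] can be cancelled over [K], which leaves the anisotropic part; this
    stays anisotropic over [K], so being metabolic there it has dimension 0. *)
Lemma metabolic_descent :
  (forall n (A : 'M[E]_n), ~ isotropic A -> ~ isotropic A^g) ->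
  forall n (A : 'M[E]_n), nondeg A -> metabolic A^g -> metabolic A.
Proof.
move=> aniso; apply: (witt_ind two_neq0) => [n A nA iA mA|].
  by apply/metabolic_dim0/(anisotropic_metabolic mA)/aniso.
move=> k n A X Y nA nX kn XYf XY0 Yh IH mA.
apply: (metabolic_split nA kn XYf XY0 Yh); apply: IH.
rewrite !map_mxM -matrix.map_trmx; apply: (@metabolic_cancel _ _ _ _ _ _ Y^g) => //.
- exact: map_nondeg.
- by rewrite -map_col_mx row_free_map.
- by rewrite matrix.map_trmx -!map_mxM XY0 map_mx0.
- by rewrite matrix.map_trmx -!map_mxM Yh map_hmx; apply: metabolic_hmx.
Qed.

(* The unramified/ramified decomposition behind Springer's theorem: t plays the
   role of a uniformizer. *)
Lemma metabolic_residue (t : K) : t != 0 ->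
  (forall n (A : 'M[E]_n), ~ isotropic A ->
     ~ isotropic (oplus A^g ((- t) *: A^g))) ->
  forall n (A : 'M[E]_n), nondeg A ->
    metabolic (oplus A^g ((- t) *: A^g)) -> metabolic A.
Proof.
move=> t0 aniso; apply: (witt_ind two_neq0) => [n A nA iA mA|].
  by apply: metabolic_dim0; have := anisotropic_metabolic mA (aniso n A iA); lia.
move=> k n A X Y nA nX kn XYf XY0 Yh IH mA.
apply: (metabolic_split nA kn XYf XY0 Yh); apply: IH.
have e l (Z : 'M_(l, n)) : oplus (Z *m A *m Z^T)^g ((- t) *: (Z *m A *m Z^T)^g) =
    block_mx Z^g 0 0 Z^g *m oplus A^g ((- t) *: A^g) *m (block_mx Z^g 0 0 Z^g)^T.
  by rewrite oplus_congr !map_mxM -matrix.map_trmx -scalemxAr -scalemxAl.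
rewrite e; apply: (@metabolic_cancel _ _ _ _ _ _ (block_mx Y^g 0 0 Y^g)) => //.
- apply: nondeg_oplus; first exact: map_nondeg.
  by apply: nondeg_scale; [rewrite oppr_eq0 | apply: map_nondeg].
- by rewrite -kn; lia.
- apply: inj_row_free => z.
  have XYg : row_free (col_mx X^g Y^g) by rewrite -map_col_mx row_free_map.
  rewrite -[z]hsubmxK -[lsubmx z]hsubmxK -[rsubmx z]hsubmxK mul_row_col !mul_row_block.
  rewrite !mulmx0 !addr0 !add0r add_row_mx => z0.
  have := congr1 lsubmx z0; have := congr1 rsubmx z0.
  rewrite row_mxKl row_mxKr !linear0 -!mul_row_col => z2 z1.
  have /(congr1 lsubmx) a1 := row_free_inj XYg (etrans z1 (esym (mul0mx _ _))).
  have /(congr1 rsubmx) a2 := row_free_inj XYg (etrans z1 (esym (mul0mx _ _))).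
  have /(congr1 lsubmx) b1 := row_free_inj XYg (etrans z2 (esym (mul0mx _ _))).
  have /(congr1 rsubmx) b2 := row_free_inj XYg (etrans z2 (esym (mul0mx _ _))).
  move: a1 a2 b1 b2; rewrite !row_mxKl !row_mxKr !linear0 => -> -> -> ->.
  by rewrite !row_mx0.
- rewrite /oplus tr_block_mx !mulmx_block !trmx0 !(mulmx0, mul0mx, addr0, add0r).
  rewrite -scalemxAr -scalemxAl matrix.map_trmx -!map_mxM XY0 map_mx0 scaler0.
  by rewrite block_mx0.
- rewrite -e Yh map_hmx; apply: metabolic_oplus (metabolic_hmx _) _.
  exact: metabolic_scale (metabolic_hmx _).
Qed.
End BaseChange.

(** * Norms from quadratic extensions *)

Section QuadraticExtension.
(** K = E + sE with s^2 = d. The element s may already lie in E, so the split case K = E is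
    covered. *)
Variables (E K : fieldType) (g : {rmorphism E -> K}) (d : E) (s : K).
Hypothesis two_neq0 : 2%:R != 0 :> E.
Hypothesis sd : s ^+ 2 = g d.
Hypothesis gen : forall z, exists x y, z = g x + s * g y.
Local Notation "M ^g" := (map_mx g M) (at level 2, format "M ^g").

Lemma quadratic_independent : (forall r, s <> g r) ->
  forall x y, g x + s * g y = 0 -> x = 0 /\ y = 0.
Proof.
move=> sNE x y xy0; have [y0|y0] := eqVneq y 0.
  split=> //; apply/eqP; move/eqP: xy0.
  by rewrite y0 rmorph0 mulr0 addr0 fmorph_eq0.
case: (sNE (- x / y)); rewrite fmorph_div rmorphN.
apply: (canRL (mulfK _)); first by rewrite fmorph_eq0.
by apply/eqP; rewrite -addr_eq0 addrC xy0.
Qed.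

Lemma quadratic_coords m n (W : 'M[K]_(m, n)) :
  exists A B : 'M[E]_(m, n), W = A^g + s *: B^g.
Proof.
have [f fP] := choice gen; have [h hP] := choice fP.
exists (map_mx f W), (map_mx h W); apply/matrixP => i j.
by rewrite !mxE -hP.
Qed.

Lemma map_mx_addZ0 m n (A B : 'M[E]_(m, n)) : (forall r, s <> g r) ->
  A^g + s *: B^g = 0 -> A = 0 /\ B = 0.
Proof.
move=> sNE /matrixP AB0; split; apply/matrixP => i j; have := AB0 i j;
  by rewrite !mxE => /(quadratic_independent sNE)[].
Qed.

(* If W = A + s B is a Lagrangian over K, then J is the E-linear map acting on
   W as multiplication by s; it is skew for Q with J^2 = d, so al + be J is a
   similitude of factor al^2 - d be^2. *)
Lemma norm_similitude a b n (Q : 'M[E]_n) :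
  a ^+ 2 - d * b ^+ 2 != 0 -> nondeg Q -> metabolic Q^g ->
  inG Q (a ^+ 2 - d * b ^+ 2).
Proof.
move=> c0; move: n Q; apply: (witt_ind two_neq0) => [n Q nQ aniso|]; last first.
  move=> k n Q X Y nQ nX kn XYf XY0 Yh IH mQ.
  apply: (inG_split nQ kn XYf XY0 Yh); apply: IH.
  rewrite !map_mxM -matrix.map_trmx; apply: (@metabolic_cancel _ _ _ _ _ _ Y^g) => //.
  - exact: map_nondeg.
  - by rewrite -map_col_mx row_free_map.
  - by rewrite matrix.map_trmx -!map_mxM XY0 map_mx0.
  - by rewrite matrix.map_trmx -!map_mxM Yh map_hmx; apply: metabolic_hmx.
have [Qs Qu] := nQ.
(* If s comes from E, so does all of K; then Q is still anisotropic over K, and being metabolic it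
   has dimension 0. *)
have [[r sr]|sNE'] := pselect (exists r, s = g r).
  move=> mQ; have n0 : n = 0%N.
    apply: (anisotropic_metabolic mQ) => -[v [v0 qv]]; apply: aniso.
    have [A [B vAB]] := quadratic_coords v.
    exists (A + r *: B); rewrite -(map_mx_eq0 g) map_mxD map_mxZ -sr -vAB.
    split=> //; apply/eqP; rewrite -(fmorph_eq0 g) -qf_map map_mxD map_mxZ -sr -vAB.
    by apply/eqP.
  split=> //; apply/isometricP; exists 1%:M; first exact: unitmx1.
  by apply/matrixP => i; case: (cast_ord n0 i).
have sNE r : s <> g r by move=> sr; apply: sNE'; exists r.
move=> [k [W [Wf W0 kn]]]; have [A [B WAB]] := quadratic_coords W.
have expand (M N : 'M[E]_k) : M^g + s *: N^g = 0 -> M = 0 /\ N = 0.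
  exact: map_mx_addZ0.
(* The components along 1 and s of [W Q W^T = 0]. *)
have [W1 W2] : A *m Q *m A^T + d *: (B *m Q *m B^T) = 0 /\
    A *m Q *m B^T + B *m Q *m A^T = 0.
  apply: expand; rewrite -W0.
  have -> : W^T = A^T^g + s *: B^T^g by rewrite WAB linearD linearZ /= !matrix.map_trmx.
  rewrite WAB !mulmxDl !mulmxDr -!scalemxAl -!scalemxAr scalerA -expr2 sd -!map_mxM.
  rewrite !map_mxD map_mxZ scalerDr -!addrA; congr (_ + _).
  by rewrite addrC -!addrA.
pose C : 'M_(k + k, n) := col_mx A B.
have Cf : row_free C.
  apply: inj_row_free => u; rewrite -[u]hsubmxK; set u1 := lsubmx u; set u2 := rsubmx u.
  (* The relation u1 A + u2 B = 0 says that (u2 + s u1)(A + s B) has no s-component. This vector of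
     the Lagrangian is thus defined over E and isotropic, hence zero. *)
  rewrite mul_row_col => u0; pose z := u2^g + s *: u1^g.
  have zW : z *m W = (u2 *m A + d *: (u1 *m B))^g.
    rewrite /z WAB mulmxDl !mulmxDr -!scalemxAl -!scalemxAr !scalerA -expr2 sd.
    rewrite map_mxD map_mxZ -!map_mxM -!addrA; congr (_ + _).
    by rewrite addrA -scalerDr -map_mxD (addrC (u2 *m B)) u0 map_mx0 scaler0 add0r.
  set r := u2 *m A + _ in zW.
  have r0 : r = 0.
    apply/eqP/negPn/negP => r0; apply: aniso; exists r; split=> //.
    apply/eqP; rewrite -(fmorph_eq0 g) -qf_map -zW /qf trmx_mul !mulmxA.
    by rewrite -2!(mulmxA z) W0 mulmx0 mul0mx mxE.
  have z0 : z = 0 by apply: (row_free_inj Wf); rewrite mul0mx zW r0 map_mx0.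
  by have [-> ->] := map_mx_addZ0 sNE z0; rewrite row_mx0.
have kkn : (k + k)%N = n by rewrite addnn -mul2n.
case: n / kkn Q nQ Qs Qu aniso W A B @C Wf W0 kn WAB W1 W2 Cf
  => Q nQ Qs Qu aniso W A B C Wf W0 kn WAB W1 W2 Cf.
have Cu : C \in unitmx by rewrite -row_free_unit.
(* Read off from s (A + s B) = d B + s A. *)
pose D : 'M_(k + k) := col_mx (d *: B) A.
pose J := invmx C *m D.
have CJ : C *m J = D by rewrite mulKVmx.
clearbody J.
have [AJ BJ] : A *m J = d *: B /\ B *m J = A.
  by apply: eq_col_mx; rewrite -mul_col_mx CJ.
have JJ : J *m J = d%:M.
  rewrite -[J *m J](mulKmx Cu) (mulmxA C) CJ mul_col_mx -scalemxAl BJ AJ.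
  by rewrite -scale_col_mx -scalemxAr mulVmx // scalemx1.
have skew : J *m Q + Q *m J^T = 0.
  have : C *m (J *m Q + Q *m J^T) *m C^T = 0.
    have -> : C *m (J *m Q + Q *m J^T) *m C^T = D *m Q *m C^T + C *m Q *m D^T.
      by rewrite mulmxDr mulmxDl !mulmxA CJ -(mulmxA (C *m Q)) -trmx_mul CJ.
    rewrite /D /C !tr_col_mx !(mul_col_mx _ _ Q) !mul_col_row add_block_mx.
    rewrite linearZ /= -!scalemxAl -!scalemxAr -scalerDr.
    rewrite (addrC (B *m Q *m A^T)) W2 scaler0 (addrC (d *: _)) W1.
    by rewrite block_mx0.
  move=> CSC; have : invmx C *m (C *m (J *m Q + Q *m J^T) *m C^T) *m invmx C^T = 0.
    by rewrite CSC mulmx0 mul0mx.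
  by rewrite !mulmxA mulVmx // mul1mx mulmxK // unitmx_tr.
pose S := a%:M + b *: J.
have QJ : Q *m J^T = - (J *m Q) by apply/eqP; rewrite -addr_eq0 addrC skew.
have SQ : S *m Q *m S^T = (a ^+ 2 - d * b ^+ 2) *: Q.
  have JQJ : J *m Q *m J^T = - (d *: Q).
    by rewrite -mulmxA QJ mulmxN mulmxA JJ mul_scalar_mx.
  rewrite /S linearD linearZ /= tr_scalar_mx mulmxDl mul_scalar_mx mulmxDr.
  rewrite mul_mx_scalar mulmxDl -!scalemxAr -!scalemxAl QJ JQJ.
  by move: (J *m Q) => T; apply/matrixP => i j; rewrite !mxE; ring.
split=> //; apply: isometric_sym; apply/isometricP; exists S => //.
have : S *m Q *m S^T \in unitmx by rewrite SQ unitmxZ // unitfE.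
by rewrite !unitmx_mul => /andP[/andP[]].
Qed.
End QuadraticExtension.

(** The split case K = E, d = s = 1 of the norm argument: every a is a difference of two squares. *)
Lemma inG_of_metabolic (E : fieldType) n (Q : 'M[E]_n) a : 2%:R != 0 :> E ->
  a != 0 -> nondeg Q -> metabolic Q -> inG Q a.
Proof.
move=> two_neq0 a0 nQ mQ.
have -> : a = ((1 + a) / 2%:R) ^+ 2 - 1 * ((1 - a) / 2%:R) ^+ 2 by field.
apply: (@norm_similitude E E idfun 1 1) => //; rewrite ?expr1n //.
- by move=> z; exists z, 0; rewrite mulr0 addr0.
- by move: a0; congr (_ != _); field.
by rewrite map_mx_id.
Qed.

Lemma quadratic_extension (E : fieldType) (d : E) : (forall r, r ^+ 2 != d) ->
  exists (K : fieldType) (g : {rmorphism E -> K}) (s : K),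
  s ^+ 2 = g d /\ forall z, exists x y, z = g x + s * g y.
Proof.
move=> nsq; pose p : {poly E} := 'X^2 - d%:P.
have sp : size p = 3%N by rewrite size_XnsubC.
have pm : p \is monic by rewrite monicXnsubC.
have pI : monic_irreducible_poly p.
  split=> //; apply: cubic_irreducible; rewrite ?sp // => x.
  by rewrite /root !hornerE subr_eq0 nsq.
have inC c : in_qpoly p c%:P = qpolyC p c.
  apply: val_inj; apply: in_qpoly_small; rewrite (mk_monicE pI) sp.
  exact: leq_ltn_trans (size_polyC_leq1 _) _.
exists {poly %/ p with pI}, (qpolyC p : {rmorphism E -> {poly %/ p}}), (in_qpoly p 'X); split.
  have p0 : in_qpoly p p = 0.
    by apply: val_inj; rewrite /= (mk_monicE pI) Pdiv.RingMonic.rmodpp.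
  move: p0; rewrite {2}/p -[in_qpoly p 'X ^+ 2]rmorphXn rmorphB /= inC => /eqP.
  by rewrite subr_eq0 => /eqP.
move=> z; exists (val z)`_0, (val z)`_1.
have zE : val z = ((val z)`_0)%:P + 'X * ((val z)`_1)%:P.
  apply/polyP => i; rewrite coefD coefC coefXM coefC.
  case: i => [|[|i]] /=; rewrite ?addr0 ?add0r //.
  apply: nth_default; have sz : size (mk_monic p) = 3%N by rewrite (mk_monicE pI).
  by apply: leq_trans (_ : 2 <= _)%N => //; rewrite -ltnS -sz; apply: size_mk_monic.
have zin : in_qpoly p (val z) = z.
  by apply: val_inj; apply: in_qpoly_small; apply: size_mk_monic.
by rewrite -[LHS]zin {1}zE rmorphD rmorphM /= !inC.
Qed.

(** * Isotropy, represented values and similarity factors *)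

Section Isotropy.
Variable E : fieldType.
Hypothesis two_neq0 : 2%:R != 0 :> E.

(** A hyperbolic plane carries the form 2xy, which takes the value a at (a/2, 1). *)
Lemma isotropic_universal n (A : 'M[E]_n) (a : E) :
  nondeg A -> isotropic A -> exists v, qf A v = a.
Proof.
move=> nA iA; have [Y Yh _] := hyperbolic_pair two_neq0 nA iA.
exists (row_mx (a / 2%:R)%:M 1%:M *m Y).
have := @qf_hmx E (a / 2%:R) 1; rewrite /qf -Yh trmx_mul !mulmxA => ->.
by field.
Qed.

Lemma inH_isotropic n (A : 'M[E]_n) a : a != 0 -> isotropic A -> inH A a.
Proof.
move=> a0 [v [v0 qv]]; split=> //; exists (row_mx v 0); split.
  by apply: contraNneq v0 => /(congr1 lsubmx); rewrite row_mxKl linear0 => ->.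
by rewrite qf_oplus qv add0r /qf mul0mx mul0mx mxE.
Qed.

Lemma inD_inH n (A : 'M[E]_n) a : inD A 1 -> inD A a -> inH A a.
Proof.
move=> [_ [e qe]] [a0 [v qv]]; split=> //; exists (row_mx v e); split.
  apply: contraNneq a0 => /(congr1 lsubmx); rewrite row_mxKl linear0 => v0.
  by rewrite -qv v0 /qf mul0mx mul0mx mxE.
by rewrite qf_oplus qfZ qv qe mulr1 subrr.
Qed.

(* On the plane spanned by u and v the product p(u) p(v) is the norm
   b(u,v)^2 - d from E(sqrt d), over which p becomes isotropic. *)
Lemma inH_inG m n (P : 'M[E]_m) (Q : 'M[E]_n) :
  nondeg P -> nondeg Q ->
  (forall (K : fieldType) (g : {rmorphism E -> K}),
     isotropic (map_mx g P) -> metabolic (map_mx g Q)) ->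
  forall a, inH P a -> inG Q a.
Proof.
move=> nP nQ PQ a [a0 [w [w0]]]; have [Ps _] := nP.
have [iP _|aP] := pselect (isotropic P).
  apply: (inG_of_metabolic two_neq0 a0 nQ).
  by have := PQ E idfun; rewrite !map_mx_id //; apply.
move: w0; rewrite -[w]hsubmxK; move: (lsubmx w) (rsubmx w) => u v w0.
rewrite qf_oplus qfZ mulNr => /eqP; rewrite subr_eq0 => /eqP quv.
have v0 : v != 0.
  apply: contraNneq w0 => v0; apply/eqP; rewrite v0.
  suff -> : u = 0 by rewrite row_mx0.
  apply/eqP/negPn/negP => u0; apply: aP; exists u; split=> //.
  by rewrite quv v0 /qf mul0mx mul0mx mxE mulr0.
have qv0 : qf P v != 0 by apply/eqP => qv; apply: aP; exists v.
pose b := (u *m P *m v^T) 0 0; pose d := b ^+ 2 - qf P u * qf P v.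
have [[r rd]|nsq] := pselect (exists r, r ^+ 2 = d).
  (* A root of the quadratic polynomial p(u + l v) in l. Anisotropy forces u = -l v, so a = l^2 is a
     square and scaling by l is the required isometry. *)
  pose l := (r - b) / qf P v.
  have uv : u + l *: v = 0.
    apply/eqP/negPn/negP => uv; apply: aP; exists (u + l *: v); split=> //.
    rewrite qfD // -/b /l; apply: (mulIf qv0); rewrite mul0r.
    transitivity (r ^+ 2 - d); last by rewrite rd subrr.
    by rewrite /d; field.
  have aE : a = l ^+ 2.
    apply: (mulIf qv0); rewrite -quv.
    have -> : u = - l *: v by apply/eqP; rewrite scaleNr -addr_eq0 uv.
    by rewrite qf_scale sqrrN.
  split=> //; apply: isometric_sym; apply/isometricP; exists l%:M.
    by rewrite unitmxE det_scalar unitfE expf_neq0 //; move: a0; rewrite aE sqrf_eq0.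
  by rewrite tr_scalar_mx mul_scalar_mx mul_mx_scalar scalerA aE.
have [K [g [s [sd gen]]]] : exists (K : fieldType) (g : {rmorphism E -> K}) (s : K),
    s ^+ 2 = g d /\ forall z, exists x y, z = g x + s * g y.
  by apply: quadratic_extension => r; apply/eqP => rd; apply: nsq; exists r.
have sNE r : s <> g r.
  move=> sr; apply: nsq; exists r; apply: (fmorph_inj g).
  by rewrite -sd sr rmorphXn.
pose l := (s - g b) / g (qf P v).
have iK : isotropic (map_mx g P).
  exists (map_mx g u + l *: map_mx g v); split.
    have [j vj] : exists j, v 0 j != 0.
      apply/existsP; apply: contraNT v0; rewrite negb_exists => /forallP h.
      by apply/eqP/rowP => i; have := h i; rewrite negbK => /eqP ->; rewrite mxE.
    apply/eqP => /rowP/(_ j); rewrite !mxE => e.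
    (* The equation u_j + l v_j = 0 solved for s, which would place s in E. *)
    apply: (sNE (b - u 0 j * qf P v / v 0 j)); rewrite rmorphB fmorph_div rmorphM.
    have gv0 : g (v 0 j) != 0 by rewrite fmorph_eq0.
    have gq0 : g (qf P v) != 0 by rewrite fmorph_eq0.
    apply/eqP; rewrite -subr_eq0 -(mulIr_eq0 _ (mulIf gv0)); apply/eqP.
    transitivity ((g (u 0 j) + l * g (v 0 j)) * g (qf P v)); last by rewrite e mul0r.
    by rewrite /l; field; rewrite gv0 gq0.
  rewrite qfD; last by rewrite matrix.map_trmx Ps.
  rewrite matrix.map_trmx -!map_mxM [X in _ * _ * X]mxE -/b !qf_map.
  have gv0 : g (qf P v) != 0 by rewrite fmorph_eq0.
  apply: (mulIf gv0); rewrite mul0r /l.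
  transitivity (s ^+ 2 - g d); last by rewrite sd subrr.
  rewrite /d rmorphB rmorphXn rmorphM; field.
  exact: gv0.
(* The norm of b + s is b^2 - d = p(u) p(v) = a p(v)^2; the square p(v)^2 is then absorbed by
   scaling with p(v). *)
have := @norm_similitude E K g d s two_neq0 sd gen b 1 n Q.
rewrite expr1n mulr1 /d opprB addrC subrK.
rewrite mulf_neq0 ?quv ?mulf_neq0 // => /(_ isT nQ (PQ K g iK)).
have -> : a * qf P v * qf P v = (qf P v) ^+ 2 * a by ring.
move=> [_ aQ]; split=> //; apply: isometric_trans aQ; apply/isometricP.
exists (qf P v)%:M; first by rewrite unitmxE det_scalar unitfE expf_neq0.
by rewrite tr_scalar_mx mul_scalar_mx mul_mx_scalar !scalerA.
Qed.
End Isotropy.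

(** * Generated subfields and fraction fields *)

Section GeneratedSubfield.
Variables (R : comNzRingType) (Om : fieldType) (psi : {rmorphism R -> Om}).

(** The fraction field of R / ker psi, realised inside [Om]: the kernel is prime because [Om] is a
    field, and the embedding comes for free. It provides both F(p) and F((x)). *)
Definition quotients : {pred Om} :=
  fun y => `[< exists a b, psi b != 0 /\ y = psi a / psi b >].

Lemma quotientsP y :
  reflect (exists a b, psi b != 0 /\ y = psi a / psi b) (y \in quotients).
Proof. exact: asboolP. Qed.

Lemma quotients_divring_closed : divring_closed quotients.
Proof.
split=> [|_ _ /quotientsP[a [b [b0 ->]]] /quotientsP[c [d [d0 ->]]]
         |_ _ /quotientsP[a [b [b0 ->]]] /quotientsP[c [d [d0 ->]]]].
- by apply/quotientsP; exists 1, 1; rewrite rmorph1 oner_neq0 divr1.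
- apply/quotientsP; exists (a * d - c * b), (b * d).
  by rewrite rmorphB !rmorphM mulf_neq0 //; split=> //; field; rewrite b0 d0.
(* Closure under division includes division by zero, whose value is 0 by convention. *)
apply/quotientsP; have [c0|c0] := eqVneq (psi c) 0.
  by exists 0, 1; rewrite c0 mul0r invr0 mulr0 rmorph0 rmorph1 oner_neq0 mul0r.
exists (a * d), (b * c); rewrite !rmorphM mulf_neq0 //; split=> //.
by field; rewrite b0 c0 d0.
Qed.

HB.instance Definition _ :=
  GRing.isDivringClosed.Build Om quotients quotients_divring_closed.

Record subfield_of := SubfieldOf
  { subfield_val :> Om; subfield_valP : subfield_val \in quotients }.
HB.instance Definition _ := [isSub for subfield_val].
HB.instance Definition _ := [Choice of subfield_of by <:].
HB.instance Definition _ := [SubChoice_isSubIntegralDomain of subfield_of by <:].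
HB.instance Definition _ := [SubIntegralDomain_isSubField of subfield_of by <:].

Lemma subfield_val_is_zmod_morphism : zmod_morphism subfield_val.
Proof. by []. Qed.
Lemma subfield_val_is_monoid_morphism : monoid_morphism subfield_val.
Proof. by []. Qed.
HB.instance Definition _ := GRing.isZmodMorphism.Build subfield_of Om
  subfield_val subfield_val_is_zmod_morphism.
HB.instance Definition _ := GRing.isMonoidMorphism.Build subfield_of Om
  subfield_val subfield_val_is_monoid_morphism.

Lemma psi_quotients a : psi a \in quotients.
Proof. by apply/quotientsP; exists a, 1; rewrite rmorph1 oner_neq0 divr1. Qed.

Definition to_subfield a : subfield_of := SubfieldOf (psi_quotients a).

Lemma to_subfield_is_zmod_morphism : zmod_morphism to_subfield.
Proof. by move=> a b; apply: val_inj; rewrite /= rmorphB. Qed.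
Lemma to_subfield_is_monoid_morphism : monoid_morphism to_subfield.
Proof. by split=> [|a b]; apply: val_inj; rewrite /= ?rmorph1 ?rmorphM. Qed.
HB.instance Definition _ :=
  GRing.isZmodMorphism.Build R subfield_of to_subfield to_subfield_is_zmod_morphism.
HB.instance Definition _ :=
  GRing.isMonoidMorphism.Build R subfield_of to_subfield to_subfield_is_monoid_morphism.

Lemma to_subfield_eq0 a : (to_subfield a == 0) = (psi a == 0).
Proof. by rewrite -val_eqE /=. Qed.

Lemma subfield_quotient (y : subfield_of) :
  exists a b, to_subfield b != 0 /\ y = to_subfield a / to_subfield b.
Proof.
have /quotientsP[a [b [b0 yab]]] := subfield_valP y.
exists a, b; rewrite to_subfield_eq0; split=> //; apply: val_inj.
by rewrite fmorph_div; exact: yab.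
Qed.
End GeneratedSubfield.

Section FractionField.
Variable R : idomainType.

(** Turns a zero of a form over the fraction field into one over the ring, where coefficients can be
    compared. *)
Lemma common_denominator n (v : 'rV[{fraction R}]_n) :
  exists (d : R) (a : 'rV[R]_n), d != 0 /\ tofrac d *: v = map_mx (@tofrac R) a.
Proof.
have fr (y : {fraction R}) : exists x : R * R, x.2 != 0 /\ tofrac x.2 * y = tofrac x.1.
  elim/quotP: y => x _; exists ((frac x).1, (frac x).2); split; first exact: denom_ratioP.
  unlock FracField.tofrac; rewrite -[LHS]FracField.pi_mul; apply/eqmodP.
  rewrite /= FracField.equivfE /FracField.mulf !numden_Ratio ?oner_neq0 ?mul1r ?denom_ratioP //.
  by rewrite mulr1.
have [f fP] := choice fr.
exists (\prod_(i < n) (f (v 0 i)).2).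
exists (\row_i ((f (v 0 i)).1 * \prod_(j < n | j != i) (f (v 0 j)).2)); split.
  by rewrite prodf_seq_neq0; apply/allP => i _ /=; apply: (proj1 (fP _)).
apply/rowP => i; rewrite !mxE (bigD1 i) //= !tofracM mulrAC.
by rewrite (proj2 (fP _)).
Qed.
End FractionField.

(** * Laurent series *)

(** A name for the carrier used in [is_laurent], to which the ring structure given by [ps_add] and
    [ps_mul] can be attached. *)
Definition pseries (E : fieldType) : Type := nat -> E.

Section PowerSeries.
Variable E : fieldType.
Local Notation ps := (pseries E).
Implicit Types a b c : ps.

HB.instance Definition _ := gen_eqMixin ps.
HB.instance Definition _ := gen_choiceMixin ps.

Let add a b : ps := ps_add a b.
Let opp a : ps := fun k => - a k.
Let zero : ps := fun _ => 0.
Let mul a b : ps := ps_mul a b.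
Let one : ps := ps_const 1.

Fact ps_addA : associative add.
Proof. by move=> a b c; apply/funext => k; rewrite /add /ps_add addrA. Qed.
Fact ps_addC : commutative add.
Proof. by move=> a b; apply/funext => k; rewrite /add /ps_add addrC. Qed.
Fact ps_add0 : left_id zero add.
Proof. by move=> a; apply/funext => k; rewrite /add /ps_add add0r. Qed.
Fact ps_addN : left_inverse zero opp add.
Proof. by move=> a; apply/funext => k; rewrite /add /ps_add addNr. Qed.
HB.instance Definition _ := GRing.isZmodule.Build ps ps_addA ps_addC ps_add0 ps_addN.

(** A coefficient of a product depends only on truncations, so associativity and commutativity are
    inherited from polynomials. *)
Lemma ps_mul_trunc N a b k : (k < N)%N ->
  ps_mul a b k = ((\poly_(i < N) a i) * (\poly_(i < N) b i))`_k.
Proof.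
move=> kN; rewrite coefM; apply: eq_bigr => i _; rewrite !coef_poly.
by rewrite !(leq_ltn_trans _ kN) ?leq_subr // -ltnS.
Qed.

Fact ps_mulA : associative mul.
Proof.
move=> a b c; apply/funext => k; rewrite /mul.
pose tr (x : ps) := \poly_(i < k.+1) x i.
transitivity ((tr a * (tr b * tr c))`_k).
  rewrite coefM; apply: eq_bigr => i _; rewrite coef_poly ltn_ord.
  by rewrite (@ps_mul_trunc k.+1) // ltnS leq_subr.
rewrite mulrA coefM; apply: eq_bigr => i _; rewrite coef_poly ltnS leq_subr.
by rewrite (@ps_mul_trunc k.+1).
Qed.
Fact ps_mulC : commutative mul.
Proof.
by move=> a b; apply/funext => k; rewrite /mul !(@ps_mul_trunc k.+1) // mulrC.
Qed.
Fact ps_mul1 : left_id one mul.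
Proof.
move=> a; apply/funext => k; rewrite /mul /ps_mul big_ord_recl /= mul1r subn0.
by rewrite big1 ?addr0 // => i _; rewrite mul0r.
Qed.
Fact ps_mulD : left_distributive mul add.
Proof.
move=> a b c; apply/funext => k; rewrite /mul /add /ps_mul /ps_add -big_split.
by apply: eq_bigr => i _; rewrite mulrDl.
Qed.
Fact ps_one_neq0 : one != 0.
Proof. by apply/eqP => /(congr1 (fun a : ps => a 0%N))/eqP; rewrite oner_eq0. Qed.
HB.instance Definition _ :=
  GRing.Zmodule_isComNzRing.Build ps ps_mulA ps_mulC ps_mul1 ps_mulD ps_one_neq0.

Lemma psM a b k : (a * b) k = \sum_(i < k.+1) a i * b (k - i)%N. Proof. by []. Qed.
Lemma ps1 k : (1 : ps) k = (k == 0%N)%:R.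
Proof. by rewrite -[LHS]/(ps_const 1 k) /ps_const; case: eqP. Qed.

Lemma ps_sum I (r : seq I) (P : pred I) (F : I -> ps) k :
  (\sum_(i <- r | P i) F i) k = \sum_(i <- r | P i) F i k.
Proof. by elim/big_rec2: _ => // i x y _ <-. Qed.

(** The first n coefficients of 1/a. Each new one solves the corresponding coefficient equation of
    the product with a; it involves all earlier ones, hence the list. *)
Fixpoint ps_inv_seq a n : seq E :=
  if n is m.+1 then
    rcons (ps_inv_seq a m)
      (((m == 0%N)%:R - \sum_(i < m) (ps_inv_seq a m)`_i * a (m - i)%N) / a 0%N)
  else [::].
Let inv a : ps := if a 0%N == 0 then a else fun m => (ps_inv_seq a m.+1)`_m.

Lemma size_ps_inv_seq a n : size (ps_inv_seq a n) = n.
Proof. by elim: n => //= n IHn; rewrite size_rcons IHn. Qed.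

Lemma nth_ps_inv_seq a n i : (i < n)%N -> (ps_inv_seq a n)`_i = (ps_inv_seq a i.+1)`_i.
Proof.
elim: n => // n IHn; rewrite ltnS leq_eqVlt => /predU1P[-> //|lt_in].
by rewrite [ps_inv_seq a n.+1]/= nth_rcons size_ps_inv_seq lt_in IHn.
Qed.

Lemma nth_ps_inv_seqS a n : (ps_inv_seq a n.+1)`_n =
  ((n == 0%N)%:R - \sum_(i < n) (ps_inv_seq a n)`_i * a (n - i)%N) / a 0%N.
Proof. by rewrite /= nth_rcons size_ps_inv_seq ltnn eqxx. Qed.
Arguments ps_inv_seq : simpl never.

Fact ps_mulV : {in [pred a : ps | a 0%N != 0], left_inverse 1 inv *%R}.
Proof.
move=> a; rewrite inE => a0; apply/funext => k; rewrite psM ps1 /inv (negbTE a0).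
rewrite big_ord_recr subnn /=.
rewrite [X in X + _](_ : _ = \sum_(i < k) (ps_inv_seq a k)`_i * a (k - i)%N); last first.
  by apply: eq_bigr => i _; rewrite (nth_ps_inv_seq _ (ltn_ord i)).
by rewrite nth_ps_inv_seqS mulfVK // addrC subrK.
Qed.
Fact ps_unitP a b : b * a = 1 -> a 0%N != 0.
Proof.
move=> /(congr1 (fun c : ps => c 0%N)); rewrite psM ps1 big_ord1 => ba.
by apply/eqP => a0; move: ba => /eqP; rewrite a0 mulr0 eq_sym oner_eq0.
Qed.
Fact ps_inv_out : {in [predC [pred a : ps | a 0%N != 0]], inv =1 id}.
Proof. by move=> a; rewrite !inE negbK /inv => ->. Qed.
HB.instance Definition _ :=
  GRing.ComNzRing_hasMulInverse.Build ps ps_mulV ps_unitP ps_inv_out.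

Lemma ps_order a : a != 0 -> exists2 n, a n != 0 & forall k, (k < n)%N -> a k = 0.
Proof.
move=> a0; have exn : exists n, a n != 0.
  apply: contrapT => nex; case/eqP: a0; apply/funext => k.
  by apply/eqP/negPn/negP => ak; apply: nex; exists k.
exists (ex_minn exn); first by case: ex_minnP.
case: ex_minnP => n _ min k kn; apply/eqP/negPn/negP => /min.
by rewrite leqNgt kn.
Qed.

(** The lowest non-zero coefficients of the factors multiply to that of the product. *)
Fact ps_integral a b : a * b = 0 -> (a == 0) || (b == 0).
Proof.
move=> ab0; apply/orP; have [a0|a0] := eqVneq a 0; first by left.
have [b0|b0] := eqVneq b 0; first by right.
have [i ai mini] := ps_order a0; have [j bj minj] := ps_order b0.
have ij : (i < (i + j).+1)%N by rewrite ltnS leq_addr.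
move: ab0 => /(congr1 (fun c : ps => c (i + j)%N)).
rewrite psM (bigD1 (Ordinal ij)) //= big1 => [|k].
  by rewrite addr0 addKn => /eqP; rewrite mulf_eq0 (negbTE ai) (negbTE bj).
rewrite -val_eqE /= neq_ltn => /orP[ki|ik]; first by rewrite mini ?mul0r.
by rewrite minj ?mulr0 //; have := ltn_ord k; lia.
Qed.
HB.instance Definition _ := GRing.ComUnitRing_isIntegral.Build ps ps_integral.

Definition psC (c : E) : ps := ps_const c.
Definition psX : ps := ps_X E.

Lemma psCM (c : E) a k : (psC c * a) k = c * a k.
Proof.
rewrite psM big_ord_recl /= subn0 big1 ?addr0 // => i _; by rewrite mul0r.
Qed.

Fact psC_is_zmod_morphism : zmod_morphism psC.
Proof.
move=> c d; apply/funext => k; change (ps_const (c - d) k = ps_const c k - ps_const d k).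
by rewrite /ps_const; case: eqP => // _; rewrite subr0.
Qed.
Fact psC_is_monoid_morphism : monoid_morphism psC.
Proof.
split=> // c d; apply/funext => k; rewrite psCM.
change (ps_const (c * d) k = c * ps_const d k); rewrite /ps_const.
by case: eqP => //; rewrite mulr0.
Qed.
HB.instance Definition _ := GRing.isZmodMorphism.Build E ps psC psC_is_zmod_morphism.
HB.instance Definition _ := GRing.isMonoidMorphism.Build E ps psC psC_is_monoid_morphism.

Lemma psXM a k : (psX * a) k = if k is k'.+1 then a k' else 0.
Proof.
rewrite psM; case: k => [|k]; first by rewrite big_ord1 mul0r.
rewrite big_ord_recl mul0r add0r big_ord_recl /= mul1r subSS subn0.
by rewrite big1 ?addr0 // => i _; rewrite mul0r.
Qed.

Lemma psXnM n a k : (psX ^+ n * a) k = if (k < n)%N then 0 else a (k - n)%N.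
Proof.
elim: n k => [|n IHn] k; first by rewrite mul1r subn0.
by rewrite exprS -mulrA psXM; case: k => // k; rewrite IHn.
Qed.

(** Reduces a quotient of two series to a series over a power of x, the shape that [is_laurent] asks
    for. *)
Lemma ps_factor a : a != 0 -> exists n u, u \is a GRing.unit /\ a = psX ^+ n * u.
Proof.
move=> /ps_order[n an min]; exists n, (fun k => a (k + n)%N); split=> //.
apply/funext => k; rewrite psXnM; case: ltnP => [/min //|nk].
by rewrite subnK.
Qed.

Lemma ps_form_coef n (A : 'M[E]_n) (a : 'rV[ps]_n) k :
  ((a *m map_mx psC A *m a^T) 0 0) k =
  \sum_(i < k.+1) (map_mx (fun c : ps => c i) a *m A *m
     (map_mx (fun c : ps => c (k - i)%N) a)^T) 0 0.
Proof.
rewrite mxE ps_sum; under eq_bigr => j _ do rewrite psM.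
rewrite exchange_big /=; apply: eq_bigr => i _; rewrite mxE; apply: eq_bigr => j _.
rewrite !mxE ps_sum; congr (_ * _); apply: eq_bigr => l _.
by rewrite !mxE mulrC psCM mulrC.
Qed.
End PowerSeries.

Section LaurentExtension.
Variable E : fieldType.
Local Notation L := {fraction pseries E}.

Definition laurentC : {rmorphism E -> L} :=
  (@tofrac (pseries E) \o @psC E : {rmorphism E -> L}).
Definition laurentX : L := tofrac (psX E).

Lemma laurentX_neq0 : laurentX != 0.
Proof.
rewrite tofrac_eq0; apply/eqP => /(congr1 (fun c : pseries E => c 1%N)) /eqP.
by rewrite oner_eq0.
Qed.

(* Coefficient 2k of q(a) - x q(c) gives q(a_k) = 0 and then coefficient 2k+1
   gives q(c_k) = 0. *)
Lemma laurent_anisotropic n (A : 'M[E]_n) : ~ isotropic A ->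
  ~ isotropic (oplus (map_mx laurentC A) ((- laurentX) *: map_mx laurentC A)).
Proof.
move=> aA [v [v0 qv]]; have [d [w [d0 dw]]] := common_denominator v.
have aA0 (u : 'rV_n) : (u *m A *m u^T) 0 0 = 0 -> u = 0.
  by move=> qu; apply/eqP/negPn/negP => u0; apply: aA; exists u.
pose form (a : 'rV[pseries E]_n) := (a *m map_mx (@psC E) A *m a^T) 0 0.
have qf_form a : qf (map_mx laurentC A) (map_mx (@tofrac _) a) = tofrac (form a).
  have -> : map_mx laurentC A = map_mx (@tofrac _) (map_mx (@psC E) A).
    by apply/matrixP => i j; rewrite !mxE.
  by rewrite /qf matrix.map_trmx -!map_mxM mxE.
set a := lsubmx w; set c := rsubmx w.
have eq0 : form a - psX E * form c = 0.
  apply/eqP; rewrite -tofrac_eq0 tofracB tofracM -!qf_form -mulNr -qfZ -qf_oplus.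
  rewrite -map_row_mx hsubmxK -dw qf_scale qv mulr0 //.
pose lvl (b : 'rV[pseries E]_n) k := map_mx (fun s : pseries E => s k) b.
(* Of two levels with sum below 2k, one is below k. *)
have lvl0 b k i j : (forall l, (l < k)%N -> lvl b l = 0) -> (i + j < k + k)%N ->
    (lvl b i *m A *m (lvl b j)^T) 0 0 = 0.
  move=> b0 ij; have [ik|ki] := ltnP i k; first by rewrite b0 // !mul0mx mxE.
  by rewrite (b0 j) ?trmx0 ?mulmx0 ?mxE //; lia.
have coefE k b : form b k = \sum_(i < k.+1) (lvl b i *m A *m (lvl b (k - i)%N)^T) 0 0.
  exact: ps_form_coef.
have coef_low b k l : (forall l, (l < k)%N -> lvl b l = 0) -> (l < k + k)%N -> form b l = 0.
  move=> b0 lk; rewrite coefE big1 // => i _; apply: (lvl0 _ k) => //.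
  by have := ltn_ord i; lia.
have coef_top b k : (forall l, (l < k)%N -> lvl b l = 0) ->
    form b (k + k)%N = (lvl b k *m A *m (lvl b k)^T) 0 0.
  move=> b0; have kk : (k < (k + k).+1)%N by rewrite ltnS leq_addr.
  rewrite coefE (bigD1 (Ordinal kk)) //= addnK big1 ?addr0 // => i.
  rewrite -val_eqE /= neq_ltn => /orP[ik|ki]; first by rewrite b0 // !mul0mx mxE.
  by rewrite (b0 (k + k - i)%N) ?trmx0 ?mulmx0 ?mxE //; have := ltn_ord i; lia.
have all0 k : lvl a k = 0 /\ lvl c k = 0.
  elim/ltn_ind: k => k IHk.
  have a0 l : (l < k)%N -> lvl a l = 0 by move=> /IHk[].
  have c0 l : (l < k)%N -> lvl c l = 0 by move=> /IHk[].
  have eqk l : form a l = (psX E * form c) l.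
    by apply/eqP; rewrite -subr_eq0 -[_ - _]/((form a - psX E * form c) l) eq0.
  (* The factor x shifts indices: coefficient 2k of x q(c) is coefficient 2k-1 of q(c), zero because
     c starts at level k. *)
  have ak : lvl a k = 0.
    apply: aA0; rewrite -coef_top // eqk psXM; case kkE : (k + k)%N => [//|l].
    by apply: (coef_low _ k) => //; rewrite kkE.
  split=> //; apply: aA0; rewrite -coef_top //.
  (* Now a starts at level k+1, so q(a) has no coefficient of index 2k+1. *)
  have := eqk (k + k).+1; rewrite psXM => <-.
  apply: (coef_low _ k.+1); last by rewrite addSn addnS.
  by move=> l; rewrite ltnS leq_eqVlt => /predU1P[->//|/a0].
case/eqP: v0; have w0 : w = 0.
  have z b : (forall k, lvl b k = 0) -> b = 0.
    move=> b0; apply/rowP => i; apply/funext => k; have /rowP/(_ i) := b0 k.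
    by rewrite !mxE.
  have a0 : a = 0 by apply: z => k; case: (all0 k).
  have c0 : c = 0 by apply: z => k; case: (all0 k).
  by rewrite -[w]hsubmxK -/a -/c a0 c0 row_mx0.
apply/eqP; have : tofrac d *: v == 0 by rewrite dw w0 map_mx0.
by rewrite scaler_eq0 tofrac_eq0 (negbTE d0).
Qed.
End LaurentExtension.

Section LaurentSubfield.
Variables (F E : fieldType) (g : {rmorphism F -> E}).

Definition ps_map (a : pseries F) : pseries E := fun k => g (a k).

Fact ps_map_is_zmod_morphism : zmod_morphism ps_map.
Proof. by move=> a b; apply/funext => k; apply: rmorphB. Qed.
Fact ps_map_is_monoid_morphism : monoid_morphism ps_map.
Proof.
split=> [|a b]; apply/funext => k; first by rewrite /ps_map !ps1 rmorph_nat.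
by rewrite /ps_map !psM rmorph_sum; apply: eq_bigr => i _; rewrite rmorphM.
Qed.
HB.instance Definition _ :=
  GRing.isZmodMorphism.Build (pseries F) (pseries E) ps_map ps_map_is_zmod_morphism.
HB.instance Definition _ :=
  GRing.isMonoidMorphism.Build (pseries F) (pseries E) ps_map ps_map_is_monoid_morphism.

(** Conditions (iii) and (v) quantify over all models of F((x)), so a convenient one may be chosen:
    the field generated by F[[x]] inside E((t)), with x sent to t. *)
Lemma laurent_subfield :
  exists (L : fieldType) (f : {rmorphism F -> L}) (x : L)
    (h : {rmorphism L -> {fraction pseries E}}),
  [/\ is_laurent f x, h x = laurentX E & forall c, h (f c) = laurentC E (g c)].
Proof.
pose psi := (@tofrac (pseries E) \o ps_map : {rmorphism pseries F -> {fraction pseries E}}).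
have psi0 a : (psi a == 0) = (a == 0).
  rewrite [psi a]/(tofrac (ps_map a)) tofrac_eq0; apply/eqP/eqP => [a0|->].
    apply/funext => k; apply: (fmorph_inj g).
    by rewrite [RHS](rmorph0 g) -[LHS]/(ps_map a k) a0.
  exact: rmorph0.
have psiX : psi (psX F) = laurentX E.
  congr tofrac; apply/funext => k; change (g (ps_X F k) = ps_X E k); rewrite /ps_X.
  by case: eqP; rewrite ?rmorph1 ?rmorph0.
exists (subfield_of psi), (to_subfield psi \o @psC F : {rmorphism F -> subfield_of psi}).
exists (to_subfield psi (psX F)), (@subfield_val _ _ psi : {rmorphism _ -> _}); split.
- exists (to_subfield psi); split=> //.
  + move=> a b ab; apply: (@subr0_eq (pseries F)).
    apply/eqP; rewrite -psi0 -to_subfield_eq0 rmorphB subr_eq0; apply/eqP; exact: ab.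
  + by move=> a b; split; [exact: rmorphD | exact: rmorphM].
  + move=> y; have [a [b [b0 ->]]] := subfield_quotient y.
    have [n [u [uU bE]]] : exists n u, u \is a GRing.unit /\ b = psX F ^+ n * u.
      by apply: ps_factor; rewrite -psi0 -to_subfield_eq0.
    pose ts : {rmorphism pseries F -> subfield_of psi} := to_subfield psi.
    have u0 : ts u != 0.
      have : ts b != 0 := b0.
      by rewrite bE rmorphM; apply: contraNneq => ->; rewrite mulr0.
    have uV : ts u^-1 = (ts u)^-1.
      by apply: (mulIf u0); rewrite mulVf // -rmorphM mulVr // rmorph1.
    exists (a * u^-1), n; change (ts a / ts b = ts (a * u^-1) / ts (psX F) ^+ n).
    by rewrite bE !rmorphM rmorphXn uV invfM mulrA mulrAC.
- exact: psiX.
move=> c; congr tofrac; apply/funext => k.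
change (g (ps_const c k) = ps_const (g c) k); rewrite /ps_const.
by case: eqP; rewrite ?rmorph0.
Qed.
End LaurentSubfield.

(** * Function fields of quadrics *)

Section FractionMPoly.
Variables (E : fieldType) (r : nat).
Local Notation Om := {fraction {mpoly E[r]}}.

Definition ratC : {rmorphism E -> Om} :=
  (@tofrac {mpoly E[r]} \o @mpolyC r E : {rmorphism E -> Om}).

Lemma mpoly_form_coef n (A : 'M[E]_n) (a : 'rV[{mpoly E[r]}]_n) k :
  ((a *m map_mx (@mpolyC r E) A *m a^T) 0 0)@_k =
  \sum_(l : 'X_{1..r < (mdeg k).+1, (mdeg k).+1} | k == (l.1 + l.2)%MM)
    (map_mx (mcoeff l.1) a *m A *m (map_mx (mcoeff l.2) a)^T) 0 0.
Proof.
rewrite mxE raddf_sum /=; under eq_bigr => j _ do rewrite mcoeffM.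
rewrite exchange_big /=; apply: eq_bigr => l _; rewrite mxE; apply: eq_bigr => j _.
rewrite !mxE raddf_sum /=; congr (_ * _); apply: eq_bigr => i _.
by rewrite !mxE mulrC mcoeffCM mulrC.
Qed.

(** Lowest terms: by induction along the monomial order, the coefficient of the monomial 2k is the
    value of A on the k-th coefficient vector, since any other pair of monomials with sum 2k has a
    member below k. *)
Lemma rat_anisotropic n (A : 'M[E]_n) : ~ isotropic A -> ~ isotropic (map_mx ratC A).
Proof.
move=> aA [v [v0 qv]]; have [d [a [d0 da]]] := common_denominator v.
have aA0 (u : 'rV_n) : (u *m A *m u^T) 0 0 = 0 -> u = 0.
  by move=> qu; apply/eqP/negPn/negP => u0; apply: aA; exists u.
have form0 : (a *m map_mx (@mpolyC r E) A *m a^T) 0 0 = 0.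
  have : qf (map_mx ratC A) (map_mx (@tofrac _) a) = 0 by rewrite -da qf_scale qv mulr0.
  have -> : map_mx ratC A = map_mx (@tofrac _) (map_mx (@mpolyC r E) A).
    by apply/matrixP => i j; rewrite !mxE.
  by rewrite /qf matrix.map_trmx -!map_mxM mxE => /eqP; rewrite tofrac_eq0 => /eqP.
have all0 k : map_mx (mcoeff k) a = 0.
  elim/(@ltmwf r): k => k IHk; apply: aA0.
  have kk : (mdeg k < (mdeg (k + k)%MM).+1)%N by rewrite mdegD ltnS leq_addr.
  have := congr1 (mcoeff (k + k)%MM) form0; rewrite mcoeff0 mpoly_form_coef.
  rewrite (bigD1 (BMultinom kk, BMultinom kk)) //= big1 ?addr0 // => -[l1 l2] /=.
  move=> /andP[/eqP kl ne].
  have [lt1|le1] := boolP ((l1 : 'X_{1..r}) < k)%O; first by rewrite IHk // !mul0mx mxE.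
  have [lt2|le2] := boolP ((l2 : 'X_{1..r}) < k)%O.
    by rewrite (IHk l2) // trmx0 mulmx0 mxE.
  rewrite -!leNgt in le1 le2; exfalso; move/negP: ne; apply.
  have [e1 e2] : bmnm l1 = k /\ bmnm l2 = k.
    move: (bmnm l1) (bmnm l2) le1 le2 kl => m1 m2; rewrite le_eqVlt => /predU1P[<-|lt1].
      by move=> _ /addmI ->.
    by move=> le2 kl; have := ltmc_le_add lt1 le2; rewrite kl ltxx.
  by rewrite xpair_eqE -!val_eqE /= e1 e2 !eqxx.
case/eqP: v0; have a0 : a = 0.
  apply/rowP => i; apply/mpolyP => k; have /rowP/(_ i) := all0 k.
  by rewrite !mxE mcoeff0.
apply/eqP; have : tofrac d *: v == 0 by rewrite da a0 map_mx0.
by rewrite scaler_eq0 tofrac_eq0 (negbTE d0).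
Qed.
End FractionMPoly.

Lemma mpoly_ring_ind (R : comNzRingType) n (P : {mpoly R[n]} -> Prop) :
  (forall c, P c%:MP) -> (forall i, P 'X_i) ->
  (forall p q, P p -> P q -> P (p + q)) -> (forall p q, P p -> P q -> P (p * q)) ->
  forall p, P p.
Proof.
move=> PC PX PD PM; apply: mpolyind => [|c k p _ _ Pp]; first by rewrite -mpolyC0.
apply: (PD) => //; rewrite -mul_mpolyC; apply: (PM) => //.
rewrite mpolyXE_id; elim/big_rec: _ => [|i q _ Pq]; first by rewrite -mpolyC1.
apply: (PM) => //; elim: (k i) => [|j IHj]; first by rewrite expr0 -mpolyC1.
by rewrite exprS; apply: PM.
Qed.

Lemma mmap_qpoly (F : fieldType) (S : comNzRingType) (f : {rmorphism F -> S}) n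
    (A : 'M[F]_n) (x : 'I_n -> S) :
  mmap f x (Defs.qpoly A) = \sum_i \sum_j f (A i j) * (x i * x j).
Proof.
rewrite /Defs.qpoly rmorph_sum /=; apply: eq_bigr => i _; rewrite rmorph_sum /=.
by apply: eq_bigr => j _; rewrite mmapZ rmorphM /= !mmapX !mmap1U.
Qed.

Lemma qf_sum (K : fieldType) n (A : 'M[K]_n) (v : 'rV_n) :
  qf A v = \sum_i \sum_j A i j * (v 0 i * v 0 j).
Proof.
rewrite /qf mxE exchange_big; apply: eq_bigr => j _; rewrite mxE mulr_suml.
by apply: eq_bigr => i _; rewrite mxE; ring.
Qed.

Lemma mmap_qpoly_qf (F K : fieldType) (f : {rmorphism F -> K}) n
    (A : 'M[F]_n) (x : 'I_n -> K) :
  mmap f x (Defs.qpoly A) = qf (map_mx f A) (\row_i x i).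
Proof.
rewrite mmap_qpoly qf_sum; apply: eq_bigr => i _; apply: eq_bigr => j _.
by rewrite !mxE.
Qed.

Section BinaryForms.
Variable E : fieldType.
Hypothesis two_neq0 : 2%:R != 0 :> E.

Lemma isotropic_hplane n (A : 'M[E]_n) : isometric A (hplane E) -> isotropic A.
Proof.
move=> i; have n2 := proj1 i; move: n2 A i => -> A /isometric_sym /isometricP[S Su <-].
exists (const_mx 1 *m invmx S); split.
  apply/eqP => /(congr1 (mulmxr S)); rewrite /= mulmxKV // mul0mx => /rowP/(_ 0).
  by rewrite !mxE => /eqP; rewrite oner_eq0.
rewrite /qf trmx_mul trmx_inv !mulmxA mulmxKV // mulmxK ?unitmx_tr //.
rewrite -/(qf (hplane E) (const_mx 1)) qf_sum !big_ord_recl !big_ord0 !mxE /=.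
by rewrite !mulr1n !mulr0n; ring.
Qed.

Lemma isometric_hplane n (A : 'M[E]_n) :
  n = 2%N -> nondeg A -> isotropic A -> isometric A (hplane E).
Proof.
move=> n2; move: n2 A => -> A nA /(hyperbolic_pair two_neq0 nA)[Y Yh _].
have hU : hmx E \in unitmx := proj2 (hmx_nondeg E).
apply: (@isometric_trans _ _ _ (hmx E)).
  by apply/isometricP; exists Y => //; move: hU; rewrite -Yh !unitmx_mul => /andP[/andP[]].
(* For the form 2xy the rows (1, 1/2) and (1, -1/2) are orthogonal with values 1 and -1. *)
pose S : 'M[E]_(1 + 1) := block_mx 1%:M (2%:R^-1)%:M 1%:M (- 2%:R^-1)%:M.
have SE : S *m hmx E *m S^T = hplane E.
  have -> : hplane E = block_mx 1%:M 0 0 (- 1%:M) :> 'M_(1 + 1).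
    have ord2 (k : 'I_(1 + 1)) : k = lshift 1 0 \/ k = rshift 1 0.
      by case: k => -[|[|//]] hk; [left | right]; apply: val_inj.
    apply/matrixP => i j; case: (ord2 i) => ->; case: (ord2 j) => ->.
    - by rewrite block_mxEul !mxE.
    - by rewrite block_mxEur !mxE.
    - by rewrite block_mxEdl !mxE.
    - by rewrite block_mxEdr !mxE.
  rewrite /S /hmx tr_block_mx !mulmx_block !tr_scalar_mx.
  rewrite !(mulmx0, mulmx1, mul1mx, addr0, add0r, mul_scalar_mx, scale_scalar_mx).
  by congr block_mx; apply/matrixP => i j; rewrite !mxE !ord1 /= ?mulr1n ?mulr0n; field.
apply/isometricP; exists S => //.
have : S *m hmx E *m S^T \in unitmx.
  rewrite SE unitmxE /hplane det_diag !big_ord_recl big_ord0 !mxE /= mulr1 mul1r.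
  by rewrite unitfE oppr_eq0 oner_eq0.
by rewrite !unitmx_mul => /andP[/andP[]].
Qed.

Lemma exists_qf_neq0 n (A : 'M[E]_n) : (0 < n)%N -> nondeg A -> exists e, qf A e != 0.
Proof.
case: n A => // n A _ nA; have [iA|aA] := pselect (isotropic A).
  have [e qe] := isotropic_universal two_neq0 1 nA iA.
  by exists e; rewrite qe oner_neq0.
exists (const_mx 1); apply/eqP => q0; apply: aA; exists (const_mx 1); split=> //.
by apply/eqP => /rowP/(_ 0); rewrite !mxE => /eqP; rewrite oner_eq0.
Qed.

(* A linear form is not a multiple of a quadratic polynomial, so the generic
   point has a non-zero coordinate. *)
Lemma function_field_isotropic n (A : 'M[E]_n) (K : fieldType) (g : {rmorphism E -> K}) :
  (2 <= n)%N -> nondeg A -> is_function_field A g -> isotropic (map_mx g A).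
Proof.
move=> n2 nA [_ ff]; have [deg|ndeg] := pselect (n = 1%N \/ isometric A (hplane E)).
  apply: map_isotropic; case: deg => [n1|/isotropic_hplane //].
  by rewrite n1 in n2.
have [x [px ker _]] := ff ndeg.
exists (\row_i x i); split; last by rewrite -mmap_qpoly_qf.
apply/eqP => x0.
have [e qe] := exists_qf_neq0 (ltnW n2) nA.
have [i ei] : exists i, e 0 i != 0.
  apply: contrapT => nex; case/eqP: qe; have -> : e = 0.
    by apply/rowP => i; rewrite mxE; apply/eqP/negPn/negP => ei; apply: nex; exists i.
  by rewrite /qf mul0mx mul0mx mxE.
have [|r rX] := ker 'X_i.
  by rewrite mmapX mmap1U; have /rowP/(_ i) := x0; rewrite !mxE.
(* Restriction to the line through e, along which p is q(e) T^2: there X_i = r p reads e_i T = r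
   q(e) T^2, impossible in degree one. *)
have := congr1 (mmap (@polyC E) (fun j => e 0 j *: 'X)) rX.
rewrite rmorphM /= mmapX mmap1U mmap_qpoly.
have -> : \sum_i \sum_j (A i j)%:P * (e 0 i *: 'X * (e 0 j *: 'X)) = qf A e *: 'X^2.
  rewrite qf_sum scaler_suml; apply: eq_bigr => k _; rewrite scaler_suml.
  by apply: eq_bigr => j _; rewrite mul_polyC -scalerAl -scalerAr !scalerA mulrA -expr2.
move=> /(congr1 (fun q : {poly E} => q`_1)) /eqP.
rewrite -scalerAr coefZ coefX mulr1 coefZ coefMXn mulr0.
by rewrite (negbTE ei).
Qed.
End BinaryForms.

Section FunctionFieldOfGenericPoint.
Variables (F Om : fieldType) (f : {rmorphism F -> Om}) (m : nat) (P : 'M[F]_m).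
Variable x : 'I_m -> Om.

(** A zero whose only relations are the multiples of p generates a copy of F(p) inside [Om]. *)
Lemma generic_function_field :
  ~ (m = 1%N \/ isometric P (hplane F)) -> mmap f x (Defs.qpoly P) = 0 ->
  (forall h, mmap f x h = 0 -> exists r, h = r * Defs.qpoly P) ->
  exists (K : fieldType) (g : {rmorphism F -> K}) (k : {rmorphism K -> Om}),
    is_function_field P g /\ forall c, k (g c) = f c.
Proof.
move=> ndeg px ker.
pose psi : {rmorphism {mpoly F[m]} -> Om} := mmap f x.
pose ts : {rmorphism {mpoly F[m]} -> subfield_of psi} := to_subfield psi.
pose g : {rmorphism F -> subfield_of psi} := ts \o @mpolyC m F.
exists (subfield_of psi), g, (@subfield_val _ _ psi : {rmorphism _ -> _}).
split; last by move=> c; rewrite /= mmapC.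
split=> // _; exists (fun i => ts 'X_i).
have mmapE h : mmap g (fun i => ts 'X_i) h = ts h.
  elim/mpoly_ring_ind: h => [c|i|p q IHp IHq|p q IHp IHq].
  - by rewrite mmapC.
  - by rewrite mmapX mmap1U.
  - by rewrite mmapD IHp IHq [RHS]rmorphD.
  - by rewrite rmorphM /= IHp IHq [RHS]rmorphM.
have ts0 h : (ts h == 0) = (mmap f x h == 0) by exact: to_subfield_eq0.
split=> [|h|y].
- by apply/eqP; rewrite mmapE ts0 px.
- by rewrite mmapE => /eqP; rewrite ts0 => /eqP /ker.
by have [a [b [b0 ->]]] := subfield_quotient y; exists a, b; rewrite !mmapE.
Qed.
End FunctionFieldOfGenericPoint.

(** Divisibility by p descends from E to F because the leading coefficient of r is a quotient of
    coefficients of h and p; subtracting that term lowers r. It is needed since the generic zero has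
    its relations computed over E, while F(p) concerns those over F. *)
Lemma mpoly_divides_descent (F E : fieldType) (g : {rmorphism F -> E}) m
    (p h : {mpoly F[m]}) (r : {mpoly E[m]}) :
  p != 0 -> map_mpoly g h = r * map_mpoly g p -> exists r', h = r' * p.
Proof.
move=> p0; have inj (q : {mpoly F[m]}) : map_mpoly g q = 0 -> q = 0.
  move=> q0; apply/mpolyP => k; apply: (fmorph_inj g).
  by rewrite -mcoeff_map_mpoly q0 !mcoeff0 rmorph0.
elim/mleadrect: r h => r IH h hr.
have [r0|r0] := eqVneq r 0; first by exists 0; rewrite mul0r; apply: inj; rewrite hr r0 mul0r.
have pE0 : map_mpoly g p != 0 by apply: contra_neq p0; apply: inj.
pose mu := mlead (map_mpoly g p).
have pmu : g p@_mu != 0 by rewrite -mcoeff_map_mpoly mleadc_eq0.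
pose c := h@_(mlead r + mu) / p@_mu.
have rc : mleadc r = g c.
  apply: (mulIf pmu); rewrite fmorph_div divfK // -!mcoeff_map_mpoly.
  by rewrite hr mleadcM mcoeff_map_mpoly.
pose r2 := r - mleadc r *: 'X_[mlead r]; pose h2 := h - c *: 'X_[mlead r] * p.
have hr2 : map_mpoly g h2 = r2 * map_mpoly g p.
  by rewrite /h2 /r2 rmorphB rmorphM /= map_mpolyZ map_mpolyX hr rc mulrBl.
have [r3 h2E] : exists r', h2 = r' * p.
  have [r20|r20] := eqVneq r2 0; last by apply: (IH r2) => //; apply: ltm_mleadD.
  by exists 0; rewrite mul0r; apply: inj; rewrite hr2 r20 mul0r.
by exists (r3 + c *: 'X_[mlead r]); rewrite mulrDl -h2E subrK.
Qed.

Lemma polarization (E : fieldType) n (B : 'M[E]_n) : 2%:R != 0 :> E ->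
  B^T = B -> (forall u, qf B u = 0) -> B = 0.
Proof.
move=> two_neq0 Bs q0; apply/matrixP => i j; rewrite mxE.
have := q0 (delta_mx 0 i + 1 *: delta_mx 0 j).
rewrite qfD // !q0 add0r mulr0 addr0 mulr1 trmx_delta -rowE -colE !mxE => /eqP.
by rewrite mulf_eq0 (negbTE two_neq0) /= => /eqP.
Qed.

(** * The generic zero in dimension at least three *)

Section GenericPoint.
Variables (E : fieldType) (m : nat) (A : 'M[E]_m) (v e : 'rV[E]_m).
Hypothesis two_neq0 : 2%:R != 0 :> E.
Hypotheses (nA : nondeg A) (v0 : v != 0) (qv : qf A v = 0).
Hypothesis ve : (v *m A *m e^T) 0 0 = 1.
Hypothesis m3 : (3 <= m)%N.
Local Notation R := {mpoly E[m]}.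
Local Notation C := (ratC E m).

Let p : R := Defs.qpoly A.
(** The linear form b(v, T), the denominator of the generic zero. *)
Let l : R := \sum_i ((v *m A) 0 i)%:MP * 'X_i.

Let ceE : \sum_i (v *m A) 0 i * e 0 i = 1.
Proof. by rewrite -ve mxE; apply: eq_bigr => i _; rewrite [e^T _ _]mxE. Qed.

Let mmap_l (S : comNzRingType) (f : {rmorphism E -> S}) (y : 'I_m -> S) :
  mmap f y l = \sum_i f ((v *m A) 0 i) * y i.
Proof.
rewrite /l rmorph_sum; apply: eq_bigr => i _.
by rewrite rmorphM /= mmapC mmapX mmap1U.
Qed.

Let l_neq0 : l != 0.
Proof.
apply/eqP => l0; have := mmap_l idfun (fun i => e 0 i); rewrite l0 rmorph0 ceE => /eqP.
by rewrite eq_sym oner_eq0.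
Qed.

(* Reduction modulo l, along the vector e with l(e) = 1. *)
Let red : {rmorphism R -> R} := mmap (@mpolyC m E) (fun i => 'X_i - l * (e 0 i)%:MP).

Let red_l : red l = 0.
Proof.
rewrite [red l]mmap_l; under eq_bigr => i _ do rewrite mulrBr mulrCA -rmorphM.
by rewrite big_split /= -/l sumrN -mulr_sumr -rmorph_sum ceE rmorph1 mulr1 subrr.
Qed.

Let red_mod h : exists r, red h = h + l * r.
Proof.
elim/mpoly_ring_ind: h => [c|i|a b [r ra] [s sb]|a b [r ra] [s sb]].
- by exists 0; rewrite mulr0 addr0 [red _]mmapC.
- by exists (- (e 0 i)%:MP); rewrite [red _]mmapX mmap1U mulrN.
- by exists (r + s); rewrite rmorphD ra sb; ring.
by exists (r * b + a * s + l * r * s); rewrite rmorphM ra sb; ring.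
Qed.

(** If l divided p, the hyperplane l = 0 would be totally isotropic, forcing 2(m - 1) <= m, against
    m >= 3. In dimension two l does divide p. *)
Let red_p : red p != 0.
Proof.
have [r pr] := red_mod p; apply/eqP => p0.
have pE : p = - (l * r) by apply/eqP; rewrite -addr_eq0 -pr p0.
have [As Au] := nA.
have [W WAv rW] : exists2 W : 'M_m, W *m (A *m v^T) = 0 & (m.-1 <= \rank W)%N.
  exists (kermx (A *m v^T)); first exact: mulmx_ker.
  by rewrite mxrank_ker mxrank_unit_mul_tr //; have := rank_leq_row v; lia.
have W0 : W *m A *m W^T = 0.
  apply: (polarization two_neq0); first by rewrite !trmx_mul trmxK As mulmxA.
  move=> u; have -> : qf (W *m A *m W^T) u = qf A (u *m W).
    by rewrite /qf trmx_mul !mulmxA.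
  have := mmap_qpoly_qf idfun A (fun i => (u *m W) 0 i); rewrite -/p.
  have -> : (\row_i (u *m W) 0 i) = u *m W by apply/rowP => i; rewrite mxE.
  rewrite map_mx_id // => <-; rewrite pE rmorphN rmorphM /= mmap_l.
  have -> : \sum_i (v *m A) 0 i * (u *m W) 0 i = 0; last by rewrite mul0r oppr0.
  transitivity ((v *m A *m (u *m W)^T) 0 0).
    by rewrite mxE; apply: eq_bigr => i _; rewrite [(u *m W)^T _ _]mxE.
  by rewrite bil_sym // -!mulmxA WAv mulmx0 mxE.
by have := rank_totally_isotropic Au W0; lia.
Qed.

(** Reduction modulo l takes values in a domain, kills l and not p. Hence it kills r, so l divides r
    and can be cancelled. *)
Lemma divides_of_linear_power N h r : l ^+ N * h = p * r -> exists r', h = r' * p.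
Proof.
elim: N r => [|N IHN] r hr; first by exists r; rewrite mulrC -hr mul1r.
have : red p * red r = 0 by rewrite -rmorphM -hr rmorphM rmorphXn red_l expr0n mul0r.
move=> /eqP; rewrite mulf_eq0 (negbTE red_p) orFb => /eqP r0.
have [s rs] := red_mod r.
apply: (IHN (- s)); apply: (mulfI l_neq0).
rewrite mulrA -exprS hr; have -> : r = - (l * s) by apply/eqP; rewrite -addr_eq0 -rs r0.
by ring.
Qed.

(* T - (p(T) / 2 b(v,T)) v, the second zero of p on the line through the
   generic vector T in the direction of v. *)
Definition generic_zero (i : 'I_m) : {fraction R} :=
  tofrac 'X_i - tofrac p / tofrac l * C (v 0 i / 2%:R).

Let tl : tofrac l != 0. Proof. by rewrite tofrac_eq0. Qed.

(** The generic zero differs from T by a multiple of p/l. So, up to powers of l, substituting it in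
    h is reading h modulo p, and h(x) = 0 puts some l^N h in (p). *)
Lemma generic_zero_mod h : exists N r,
  tofrac l ^+ N * mmap C generic_zero h = tofrac (l ^+ N * h + p * r).
Proof.
elim/mpoly_ring_ind: h => [c|i|a b [M [r ra]] [N [s sb]]|a b [M [r ra]] [N [s sb]]].
- by exists 0%N, 0; rewrite mmapC !mul1r mulr0 addr0.
- exists 1%N, (- (v 0 i / 2%:R)%:MP); rewrite mmapX mmap1U /generic_zero !expr1.
  have aux (K : fieldType) (a b x y : K) : a != 0 -> a * (x - b / a * y) = a * x + b * - y.
    by move=> a0; field.
  by move: (v 0 i / 2%:R) => c; rewrite rmorphD !rmorphM rmorphN /= aux.
- exists (M + N)%N, (l ^+ N * r + l ^+ M * s); rewrite mmapD.
  transitivity (tofrac l ^+ N * tofrac (l ^+ M * a + p * r) +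
     tofrac l ^+ M * tofrac (l ^+ N * b + p * s)).
    by rewrite -ra -sb exprD mulrDr mulrCA mulrA [tofrac l ^+ M * (_ * _)]mulrA.
  by rewrite -!rmorphXn -!rmorphM -rmorphD /= exprD; congr tofrac; ring.
exists (M + N)%N, (l ^+ M * a * s + r * l ^+ N * b + p * r * s).
rewrite rmorphM /= exprD mulrACA ra sb -rmorphM /= exprD.
by congr tofrac; ring.
Qed.

Lemma generic_zero_kernel h : mmap C generic_zero h = 0 -> exists r, h = r * p.
Proof.
move=> h0; have [N [r]] := generic_zero_mod h; rewrite h0 mulr0.
move=> /eqP; rewrite eq_sym tofrac_eq0 addr_eq0 -mulrN => /eqP.
exact: divides_of_linear_power.
Qed.

Lemma generic_zeroP : mmap C generic_zero p = 0.
Proof.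
have [As _] := nA; pose T : 'rV[{fraction R}]_m := \row_i tofrac 'X_i.
pose mu : {fraction R} := - (tofrac p / tofrac l / 2%:R).
have C2 : C (2%:R^-1) = 2%:R^-1 by rewrite fmorphV rmorph_nat.
have two' : 2%:R != 0 :> {fraction R} by rewrite -(rmorph_nat C) fmorph_eq0.
rewrite mmap_qpoly_qf.
have -> : (\row_i generic_zero i) = T + mu *: map_mx C v.
  apply/rowP => i; rewrite !mxE /generic_zero /mu rmorphM C2.
  by rewrite mulNr; congr (_ - _); rewrite mulrCA mulrC.
rewrite qfD ?matrix.map_trmx ?As // -matrix.map_trmx qf_map qv rmorph0 mulr0 addr0.
have -> : qf (map_mx C A) T = tofrac p.
  rewrite -(mmap_qpoly_qf C A (fun i => tofrac 'X_i)) -/p.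
  elim/mpoly_ring_ind: p => [c|i|a b IHa IHb|a b IHa IHb].
  - by rewrite mmapC.
  - by rewrite mmapX mmap1U.
  - by rewrite mmapD IHa IHb -rmorphD.
  - by rewrite rmorphM /= IHa IHb -rmorphM.
have -> : (T *m map_mx C A *m (map_mx C v)^T) 0 0 = tofrac l.
  rewrite bil_sym ?matrix.map_trmx ?As // -map_mxM mxE /l rmorph_sum.
  by apply: eq_bigr => i _; rewrite rmorphM /= [map_mx _ _ _ _]mxE [T^T _ _]mxE [T _ _]mxE.
have aux (K : fieldType) (a b : K) : 2%:R != 0 :> K -> b != 0 ->
    a + 2%:R * - (a / b / 2%:R) * b = 0.
  by move=> t b0; field; rewrite b0 t.
by rewrite /mu (aux _ _ _ two' tl).
Qed.
End GenericPoint.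

(** * The generic zero of an anisotropic binary form *)

Section BinaryGenericPoint.
Variables (F E : fieldType) (g : {rmorphism F -> E}) (P : 'M[F]_2) (theta : E).
Local Notation C := (ratC E 2).
Local Notation i1 := (lift ord0 ord0 : 'I_2).
Local Notation v := (\row_(i < 2) if i == ord0 then theta else 1).
Hypothesis aniso : ~ isotropic P.
Hypothesis zero_theta : qf (map_mx g P) v = 0.

Let theta_notin c : theta <> g c.
Proof.
move=> tc; apply: aniso; exists (\row_(i < 2) if i == ord0 then c else 1); split.
  by apply/eqP => /rowP/(_ i1); rewrite !mxE /= => /eqP; rewrite oner_eq0.
apply: (fmorph_inj g); rewrite rmorph0 -qf_map -zero_theta; congr qf.
by apply/rowP => i; rewrite !mxE; case: ifP; rewrite ?rmorph1.
Qed.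

Let theta_free a b : g a + g b * theta = 0 -> a = 0 /\ b = 0.
Proof.
move=> ab; have b0 : b = 0.
  apply/eqP/negPn/negP => b0; apply: (@theta_notin (- a / b)).
  have gb : g b != 0 by rewrite fmorph_eq0.
  apply: (mulIf gb); rewrite fmorph_div divfK // rmorphN mulrC.
  by apply/eqP; rewrite -addr_eq0 addrC ab.
by move: ab; rewrite b0 rmorph0 mul0r addr0 => /eqP; rewrite fmorph_eq0 => /eqP.
Qed.

Let P00_neq0 : P 0 0 != 0.
Proof.
apply/eqP => P0; apply: aniso; exists (delta_mx 0 0); split.
  by apply/eqP => /rowP/(_ 0); rewrite !mxE => /eqP; rewrite oner_eq0.
by rewrite /qf trmx_delta -rowE -colE !mxE.
Qed.

(** A polynomial read in the second variable X_1. Anisotropy gives p a non-zero X_0^2 term, so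
    modulo p every polynomial is [hat a + hat b * 'X_ord0]. *)
Let hat (a : {poly F}) : {mpoly F[2]} := (map_poly (@mpolyC 2 F) a).['X_i1].

Let hatD a b : hat (a + b) = hat a + hat b.
Proof. by rewrite /hat rmorphD hornerD. Qed.
Let hatM a b : hat (a * b) = hat a * hat b.
Proof. by rewrite /hat rmorphM hornerM. Qed.
Let hatC c : hat c%:P = c%:MP.
Proof. by rewrite /hat map_polyC hornerC. Qed.
Let hatX : hat 'X = 'X_i1.
Proof. by rewrite /hat map_polyX hornerX. Qed.

Let square_reduction : exists u s t,
  'X_ord0 * 'X_ord0 = u * Defs.qpoly P + (hat s + hat t * 'X_ord0).
Proof.
exists ((P 0 0)^-1)%:MP, ((- (P i1 i1 / P 0 0))%:P * ('X * 'X)),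
  ((- ((P 0 i1 + P i1 0) / P 0 0))%:P * 'X).
rewrite !hatM !hatC !hatX /Defs.qpoly !big_ord_recl !big_ord0 -!mul_mpolyC.
set X0 := 'X_ord0; set X1 := 'X_i1.
have aux (R : comNzRingType) (w a b c d : R) : w * a = 1 ->
  forall x y, x * x =
    w * (a * (x * x) + (b * (x * y) + 0) + (c * (y * x) + (d * (y * y) + 0) + 0))
      + (- (d * w) * (y * y) + - ((b + c) * w) * y * x).
  move=> wa x y; transitivity ((w * a) * (x * x)); first by rewrite wa mul1r.
  by ring.
rewrite (rmorphN (@mpolyC 2 F)) [in X in - X * (X1 * X1)]rmorphM.
rewrite (rmorphN (@mpolyC 2 F)) [in X in - X * X1]rmorphM rmorphD; apply: aux.
by rewrite -rmorphM mulVf // rmorph1.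
Qed.

Let reduction h : exists r a b, h = r * Defs.qpoly P + (hat a + hat b * 'X_ord0).
Proof.
have [u [s [t uE]]] := square_reduction.
elim/mpoly_ring_ind: h => [c|i|p q [r [a [b pE]]] [r' [c [d qE]]]
                          |p q [r [a [b pE]]] [r' [c [d qE]]]].
- by exists 0, c%:P, 0%:P; rewrite !hatC mpolyC0 !mul0r add0r addr0.
- have [->|->] : i = ord0 \/ i = i1.
    by case: i => -[|[|//]] hi; [left | right]; apply: val_inj.
  + by exists 0, 0%:P, 1%:P; rewrite !hatC mpolyC0 mpolyC1 mul0r !add0r mul1r.
  by exists 0, 'X, 0%:P; rewrite hatX hatC mpolyC0 !mul0r add0r addr0.
- exists (r + r'), (a + c), (b + d); rewrite pE qE !hatD; by ring.
exists (r * r' * Defs.qpoly P + r * (hat c + hat d * 'X_ord0) + r' * (hat a + hat b * 'X_ord0)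
    + hat b * hat d * u).
exists (a * c + b * d * s), (a * d + b * c + b * d * t).
rewrite pE qE !hatD !hatM.
have aux (R : comNzRingType) (k x a' b' c' d' u' s' t' r1 r2 : R) :
  x * x = u' * k + (s' + t' * x) ->
  (r1 * k + (a' + b' * x)) * (r2 * k + (c' + d' * x)) =
  (r1 * r2 * k + r1 * (c' + d' * x) + r2 * (a' + b' * x) + b' * d' * u') * k +
  (a' * c' + b' * d' * s' + (a' * d' + b' * c' + b' * d' * t') * x).
  move=> xx; transitivity ((r1 * r2 * k + r1 * (c' + d' * x) + r2 * (a' + b' * x)) * k
     + a' * c' + (a' * d' + b' * c') * x + b' * d' * (x * x)); first by ring.
  by rewrite xx; ring.
exact: aux.
Qed.

Let T : {fraction {mpoly E[2]}} := tofrac 'X_ord0.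
(** The factor T is essential: the bare zero (theta, 1) satisfies the extra relation X_1 = 1. *)
Definition binary_zero (i : 'I_2) : {fraction {mpoly E[2]}} :=
  T * C (if i == ord0 then theta else 1).
Let f : {rmorphism F -> {fraction {mpoly E[2]}}} := C \o g.

Lemma binary_zeroP : mmap f binary_zero (Defs.qpoly P) = 0.
Proof.
rewrite mmap_qpoly_qf map_mx_comp.
have -> : \row_i binary_zero i = T *: map_mx C v by apply/rowP => i; rewrite !mxE.
by rewrite qf_scale qf_map zero_theta rmorph0 mulr0.
Qed.

Lemma poly_mpoly_inj (A : {poly E}) :
  (map_poly (@mpolyC 2 E) A).['X_ord0] = 0 -> A = 0.
Proof.
move=> A0; pose phi : {rmorphism {mpoly E[2]} -> {poly E}} := mmap (@polyC E) (fun=> 'X).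
have := rmorph0 phi; rewrite -A0 -horner_map /= mmapX mmap1U -map_poly_comp.
rewrite (eq_map_poly (g := @polyC E)); last by move=> c; rewrite /= mmapC.
by rewrite -[(map_poly _ _).['X]]/(A \Po 'X) comp_polyXr.
Qed.

(** The remainder of h modulo p takes the value a(T) + theta T b(T). Comparing coefficients of T,
    the independence of 1 and theta over F gives a = b = 0. *)
Lemma binary_zero_kernel h : mmap f binary_zero h = 0 -> exists r, h = r * Defs.qpoly P.
Proof.
have [r [a [b hE]]] := reduction h => h0; exists r.
have hatE q : mmap f binary_zero (hat q) =
    tofrac (map_poly (@mpolyC 2 E) (map_poly g q)).['X_ord0].
  rewrite /hat -!horner_map /= mmapX mmap1U -!map_poly_comp /binary_zero rmorph1 mulr1 -/T.
  by congr (_.[_]); apply: eq_map_poly => c; rewrite /= mmapC.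
have A0 : map_poly g a + map_poly g b * (theta%:P * 'X) = 0.
  apply: poly_mpoly_inj; apply/eqP; rewrite -tofrac_eq0; apply/eqP.
  rewrite -h0 hE [in RHS]rmorphD [in RHS]rmorphM /= binary_zeroP mulr0 add0r.
  rewrite [in RHS]rmorphD [in RHS]rmorphM /= !hatE mmapX mmap1U /binary_zero /=.
  rewrite rmorphD !rmorphM /= map_polyC map_polyX hornerD !hornerM hornerC hornerX.
  by rewrite rmorphD !rmorphM /= [X in _ * X]mulrC.
have coefs k : a`_k = 0 /\ b`_k = 0.
  have b0 j : b`_j = 0 /\ a`_j.+1 = 0.
    have := congr1 (fun q : {poly E} => q`_j.+1) A0.
    rewrite coefD mulrA coefMX /= coefMC !coef_map coef0 => /theta_free[]; by split.
  split; last by case: (b0 k).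
  case: k => [|k]; last by case: (b0 k).
  have := congr1 (fun q : {poly E} => q`_0) A0.
  rewrite coefD mulrA coefMX /= addr0 coef_map coef0 => /eqP.
  by rewrite fmorph_eq0 => /eqP.
have a0 : a = 0 by apply/polyP => k; rewrite coef0; case: (coefs k).
have b0 : b = 0 by apply/polyP => k; rewrite coef0; case: (coefs k).
by rewrite hE a0 b0 /hat map_poly0 horner0 mul0r !addr0.
Qed.
End BinaryGenericPoint.

Lemma mmap_map_mpoly (F E : fieldType) (S : comNzRingType) (g : {rmorphism F -> E})
    (f : {rmorphism E -> S}) n (x : 'I_n -> S) h :
  mmap (f \o g : {rmorphism F -> S}) x h = mmap f x (map_mpoly g h).
Proof.
elim/mpoly_ring_ind: h => [c|i|p q IHp IHq|p q IHp IHq].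
- by rewrite map_mpolyC !mmapC.
- by rewrite map_mpolyX !mmapX !mmap1U.
- by rewrite mmapD IHp IHq [map_mpoly g (p + q)]rmorphD -mmapD.
by rewrite rmorphM /= IHp IHq [map_mpoly g (p * q)]rmorphM [RHS]rmorphM.
Qed.

Lemma generic_point (F E : fieldType) (g : {rmorphism F -> E}) m (P : 'M[F]_m) :
  2%:R != 0 :> F -> nondeg P -> (2 <= m)%N -> ~ isometric P (hplane F) ->
  isotropic (map_mx g P) ->
  exists x : 'I_m -> {fraction {mpoly E[m]}},
    mmap (ratC E m \o g : {rmorphism F -> _}) x (Defs.qpoly P) = 0 /\
    forall h, mmap (ratC E m \o g : {rmorphism F -> _}) x h = 0 ->
      exists r, h = r * Defs.qpoly P.
Proof.
move=> two_neq0 nP; rewrite leq_eqVlt => /predU1P[m2|m3] nhyp [v [v0 qv]].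
  have aniso : ~ isotropic P.
    by move=> iP; apply: nhyp; apply: isometric_hplane (esym m2) nP iP.
  case: m / m2 P nP nhyp aniso v v0 qv => P nP nhyp aniso v v0 qv.
  (* Otherwise v is a multiple of the first basis vector, which would already be isotropic over
     F. *)
  have v1 : v 0 (lift ord0 ord0) != 0.
    apply/eqP => v1; have vE : v = v 0 ord0 *: delta_mx 0 ord0.
      apply/rowP => i; rewrite !mxE eqxx /=.
      have [->|->] : i = ord0 \/ i = lift ord0 ord0.
        by case: i => -[|[|//]] hi; [left | right]; apply: val_inj.
        by rewrite mulr1.
      by rewrite v1 mulr0.
    move: qv; rewrite vE qf_scale => /eqP; rewrite mulf_eq0 expf_eq0 /= => /orP[/eqP z|/eqP z].
      by case/eqP: v0; rewrite vE z scale0r.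
    apply: aniso; exists (delta_mx 0 ord0); split.
      by apply/eqP => /rowP/(_ 0); rewrite !mxE => /eqP; rewrite oner_eq0.
    by apply: (fmorph_inj g); rewrite rmorph0 -qf_map map_delta_mx.
  pose theta := v 0 ord0 / v 0 (lift ord0 ord0).
  have zt : qf (map_mx g P) (\row_(i < 2) if i == ord0 then theta else 1) = 0.
    set w := \row_(_ < 2) _; have vE : v = v 0 (lift ord0 ord0) *: w.
      apply/rowP => i; rewrite !mxE.
      have [->|->] : i = ord0 \/ i = lift ord0 ord0.
        by case: i => -[|[|//]] hi; [left | right]; apply: val_inj.
        by rewrite /= mulrC divfK.
      by rewrite /= mulr1.
    move: qv; rewrite vE qf_scale => /eqP.
    by rewrite mulf_eq0 expf_eq0 (negbTE v1) andbF => /eqP.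
  exists (binary_zero theta); split; first exact: binary_zeroP.
  exact: (binary_zero_kernel aniso zt).
have two' : 2%:R != 0 :> E by rewrite -(rmorph_nat g) fmorph_eq0.
have nPg := map_nondeg g nP.
have [e ve] := dual_vector (proj2 nPg) v0.
have mE h : mmap (ratC E m \o g : {rmorphism F -> _}) (generic_zero (map_mx g P) v) h =
    mmap (ratC E m) (generic_zero (map_mx g P) v) (map_mpoly g h).
  exact: mmap_map_mpoly.
have pE : map_mpoly g (Defs.qpoly P) = Defs.qpoly (map_mx g P).
  rewrite /Defs.qpoly rmorph_sum; apply: eq_bigr => i _; rewrite rmorph_sum.
  by apply: eq_bigr => j _; rewrite /= map_mpolyZ rmorphM /= !map_mpolyX mxE.
exists (generic_zero (map_mx g P) v); split=> [|h].
  by rewrite mE pE; apply: (generic_zeroP two' nPg qv ve).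
rewrite mE => /(generic_zero_kernel two' nPg v0 ve m3)[r hr].
apply: (@mpoly_divides_descent F E g m _ _ r); last by rewrite pE.
have [w qw] := exists_qf_neq0 two_neq0 (ltnW (ltnW m3)) nP.
apply/eqP => p0; case/eqP: qw; have := mmap_qpoly_qf idfun P (fun i => w 0 i).
rewrite p0 rmorph0 map_mx_id // => ->; congr qf.
by apply/rowP => i; rewrite mxE.
Qed.

Lemma function_field_metabolic (F E : fieldType) (g : {rmorphism F -> E}) m n
    (P : 'M[F]_m) (Q : 'M[F]_n) :
  2%:R != 0 :> F -> nondeg P -> nondeg Q -> (2 <= m)%N ->
  (forall (K : fieldType) (f : {rmorphism F -> K}),
     is_function_field P f -> hyperbolic (map_mx f Q)) ->
  isotropic (map_mx g P) -> metabolic (map_mx g Q).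
Proof.
move=> two_neq0 nP nQ m2 hypQ iP.
(* For a hyperbolic plane F(p) = F by convention, so q itself is hyperbolic. *)
have [hP|hP] := pselect (isometric P (hplane F)).
  apply: map_metabolic; rewrite -[Q](@map_mx_id _ _ _ idfun) //.
  apply/hyperbolicP; first by rewrite map_mx_id //; case: nQ.
  by apply: hypQ; split=> [_|[]]; [exists idfun | right].
have ndeg : ~ (m = 1%N \/ isometric P (hplane F)) by case=> // m1; rewrite m1 in m2.
have [x [px ker]] := generic_point two_neq0 nP m2 hP iP.
have [K [f [k [ff kf]]]] := generic_function_field ndeg px ker.
have two' : 2%:R != 0 :> E by rewrite -(rmorph_nat g) fmorph_eq0.
apply: (metabolic_descent two' (@rat_anisotropic E m)); first exact: map_nondeg.
have -> : map_mx (ratC E m) (map_mx g Q) = map_mx k (map_mx f Q).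
  by apply/matrixP => i j; rewrite !mxE kf.
apply: map_metabolic; apply/hyperbolicP; first by case: (map_nondeg f nQ).
exact: hypQ.
Qed.

(** * Descent from E((t)) and the equivalences *)

Lemma laurent_metabolic (E : fieldType) n (A : 'M[E]_n) : 2%:R != 0 :> E -> nondeg A ->
  metabolic (oplus (map_mx (laurentC E) A) ((- laurentX E) *: map_mx (laurentC E) A)) ->
  metabolic A.
Proof.
move=> two_neq0; apply: metabolic_residue => //; first exact: laurentX_neq0.
exact: laurent_anisotropic.
Qed.

Lemma laurent_var_neq0 (F L : fieldType) (f : {rmorphism F -> L}) (x : L) :
  is_laurent f x -> x != 0.
Proof.
move=> [phi [phi_inj _ phiC phiX _]]; apply/eqP => x0.
have /phi_inj/(congr1 (fun a => a 1%N))/eqP : phi (ps_X F) = phi (ps_const 0).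
  by rewrite phiX phiC rmorph0.
by rewrite oner_eq0.
Qed.

(** A zero with non-zero last coordinate can be normalised there; with last coordinate zero it makes
    A isotropic, hence universal. *)
Lemma isotropic_inD (E : fieldType) n (A : 'M[E]_n) a : 2%:R != 0 :> E ->
  nondeg A -> a != 0 -> isotropic (oplus A ((- a)%:M : 'M_1)) -> inD A a.
Proof.
move=> two_neq0 nA a0 [w [w0 qw]]; split=> //.
move: w0 qw; rewrite -[w]hsubmxK; move: (lsubmx w) (rsubmx w) => u s w0.
rewrite qf_oplus; have -> : qf ((- a)%:M : 'M_1) s = - a * s 0 0 ^+ 2.
  by rewrite qf_sum !big_ord1 !mxE eqxx mulr1n expr2.
rewrite mulNr => /eqP; rewrite subr_eq0 => /eqP qu.
have [s0|s0] := eqVneq (s 0 0) 0; last first.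
  exists ((s 0 0)^-1 *: u); rewrite qf_scale qu exprVn mulrCA mulVf ?mulr1 //.
  by rewrite expf_neq0.
apply: isotropic_universal => //; exists u; split; last by rewrite qu s0 expr0n mulr0.
apply: contraNneq w0 => u0; apply/eqP; rewrite u0.
suff -> : s = 0 by rewrite row_mx0.
by apply/rowP => i; rewrite !ord1 s0 mxE.
Qed.

Theorem theorem2p12 (F : fieldType) (m n : nat) (P : 'M[F]_m) (Q : 'M[F]_n) :
  (2%:R : F) != 0 -> is_form P -> is_form Q -> (2 <= m)%N -> (2 <= n)%N ->
  let cond_i := forall (K : fieldType) (g : {rmorphism F -> K}),
      is_function_field P g -> hyperbolic (map_mx g Q) in
  let cond_ii := forall (K : fieldType) (f : {rmorphism F -> K}) (a : K),
      inH (map_mx f P) a -> inG (map_mx f Q) a in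
  let cond_iii := forall (L : fieldType) (f : {rmorphism F -> L}) (x : L),
      is_laurent f x ->
      forall (M : fieldType) (g : {rmorphism L -> M}),
        is_function_field (oplus (map_mx f P) ((- x) *: map_mx f P)) g ->
        hyperbolic (map_mx g (oplus (map_mx f Q) ((- x) *: map_mx f Q))) in
  let cond_iv := forall (K : fieldType) (f : {rmorphism F -> K}) (a : K),
      inD (map_mx f P) a -> inG (map_mx f Q) a in
  let cond_v := forall (L : fieldType) (f : {rmorphism F -> L}) (x : L),
      is_laurent f x ->
      forall (M : fieldType) (g : {rmorphism L -> M}),
        is_function_field (oplus (map_mx f P) ((- x)%:M : 'M[L]_1)) g ->
        hyperbolic (map_mx g (oplus (map_mx f Q) ((- x) *: map_mx f Q))) in
  [/\ cond_i <-> cond_ii, cond_i <-> cond_iii &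
      (inD P 1 -> (cond_i <-> cond_iv) /\ (cond_i <-> cond_v))].
Proof.
move=> two_neq0 /is_form_nondeg nP /is_form_nondeg nQ m2 n2.
move=> cond_i cond_ii cond_iii cond_iv cond_v.
have two (K : fieldType) (f : {rmorphism F -> K}) : 2%:R != 0 :> K.
  by rewrite -(rmorph_nat f) fmorph_eq0.
pose isotropic_metabolic := forall (E : fieldType) (g : {rmorphism F -> E}),
  isotropic (map_mx g P) -> metabolic (map_mx g Q).
have comp (K M : fieldType) (f : {rmorphism F -> K}) (g : {rmorphism K -> M}) k
    (A : 'M[F]_k) : map_mx g (map_mx f A) = map_mx (g \o f : {rmorphism F -> M}) A.
  by apply/matrixP => i j; rewrite !mxE.
have map_iii (K M : fieldType) (f : {rmorphism F -> K}) (g : {rmorphism K -> M}) x k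
    (A : 'M[F]_k) : map_mx g (oplus (map_mx f A) ((- x) *: map_mx f A)) =
    oplus (map_mx (g \o f : {rmorphism F -> M}) A)
      ((- g x) *: map_mx (g \o f : {rmorphism F -> M}) A).
  by rewrite map_oplus map_mxZ rmorphN comp.
have map_v (K M : fieldType) (f : {rmorphism F -> K}) (g : {rmorphism K -> M}) x :
    map_mx g (oplus (map_mx f P) ((- x)%:M : 'M_1)) =
    oplus (map_mx (g \o f : {rmorphism F -> M}) P) ((- g x)%:M : 'M_1).
  by rewrite map_oplus map_scalar_mx rmorphN comp.
have nmap (K : fieldType) (f : {rmorphism F -> K}) k (A : 'M_k) :
    nondeg A -> nondeg (map_mx f A).
  exact: map_nondeg.
have nscaled (K : fieldType) (f : {rmorphism F -> K}) x k (A : 'M_k) : x != 0 -> nondeg A ->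
    nondeg (oplus (map_mx f A) ((- x) *: map_mx f A)).
  move=> x0 nA; apply: nondeg_oplus; first exact: nmap.
  by apply: nondeg_scale; [rewrite oppr_eq0 | apply: nmap].
have i_met : cond_i -> isotropic_metabolic.
  by move=> ci E g; apply: function_field_metabolic.
have met_i : isotropic_metabolic -> cond_i.
  move=> met K g ff; apply/hyperbolicP; first by case: (nmap K g n Q nQ).
  by apply: met; apply: function_field_isotropic => //.
have met_ii : isotropic_metabolic -> cond_ii.
  move=> met K f a; apply: inH_inG; rewrite ?(two K f) //; try exact: nmap.
  by move=> M g; rewrite !comp; apply: met.
have inG_met (E : fieldType) (g : {rmorphism F -> E}) :
    inG (map_mx (laurentC E \o g : {rmorphism F -> _}) Q) (laurentX E) ->
    metabolic (map_mx g Q).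
  move=> GX; apply: laurent_metabolic; [exact: (two _ g) | exact: nmap |].
  rewrite comp; apply: inG_metabolic GX.
  by case: (nmap _ (laurentC E \o g : {rmorphism F -> _}) n Q nQ).
have iso_laurent (E : fieldType) (g : {rmorphism F -> E}) : isotropic (map_mx g P) ->
    isotropic (map_mx (laurentC E \o g : {rmorphism F -> _}) P).
  by move=> iP; rewrite -comp; apply: map_isotropic.
have ii_met : cond_ii -> isotropic_metabolic.
  move=> cii E g iP; apply: inG_met; apply: cii.
  by apply: inH_isotropic; [exact: laurentX_neq0 | exact: iso_laurent].
have ii_hyp (L M : fieldType) (f : {rmorphism F -> L}) (g : {rmorphism L -> M}) x : x != 0 ->
    inG (map_mx (g \o f : {rmorphism F -> M}) Q) (g x) ->
    hyperbolic (map_mx g (oplus (map_mx f Q) ((- x) *: map_mx f Q))).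
  move=> x0 Gx; apply/hyperbolicP.
    by rewrite map_unitmx; case: (nscaled L f x n Q x0 nQ).
  rewrite map_iii; apply: inG_metabolic Gx.
  by case: (nmap M (g \o f : {rmorphism F -> M}) n Q nQ).
(* Over its function field p _|_ -xp is isotropic, which says that x lies in H(p); by (ii) it is a
   similarity factor of q. *)
have ii_iii : cond_ii -> cond_iii.
  move=> cii L f x lx M g ff; have x0 := laurent_var_neq0 lx.
  apply: ii_hyp => //; apply: cii; split; first by rewrite fmorph_eq0.
  rewrite -map_iii; apply: function_field_isotropic ff; [exact: (two _ f) | | exact: nscaled].
  by rewrite (leq_trans m2) // leq_addr.
have lift_met (E : fieldType) (g : {rmorphism F -> E}) (L : fieldType) (f : {rmorphism F -> L})
    (x : L) (h : {rmorphism L -> {fraction pseries E}}) :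
    h x = laurentX E -> (forall c, h (f c) = laurentC E (g c)) ->
    metabolic (map_mx h (oplus (map_mx f Q) ((- x) *: map_mx f Q))) -> metabolic (map_mx g Q).
  move=> hx hf; rewrite map_iii hx.
  have -> : map_mx (h \o f : {rmorphism F -> _}) Q = map_mx (laurentC E) (map_mx g Q).
    by apply/matrixP => i j; rewrite !mxE /= hf.
  by apply: laurent_metabolic; [exact: (two _ g) | exact: nmap].
have lift_iso (E : fieldType) (g : {rmorphism F -> E}) (L : fieldType) (f : {rmorphism F -> L})
    (h : {rmorphism L -> {fraction pseries E}}) :
    (forall c, h (f c) = laurentC E (g c)) -> isotropic (map_mx g P) ->
    isotropic (map_mx (h \o f : {rmorphism F -> _}) P).
  move=> hf /iso_laurent; congr isotropic.
  by apply/matrixP => i j; rewrite !mxE /= hf.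
have iii_met : cond_iii -> isotropic_metabolic.
  move=> ciii E g iP; have [L [f [x [h [lx hx hf]]]]] := laurent_subfield g.
  have x0 := laurent_var_neq0 lx; apply: (lift_met E g L f x h hx hf).
  (* The step from (i) to (i'), taken over L for p _|_ -xp and q _|_ -xq and the extension E((t)) of
     L, where p is isotropic. *)
  apply: function_field_metabolic (ciii L f x lx) _;
    [exact: (two _ f) | exact: nscaled | exact: nscaled
    | by rewrite (leq_trans m2) // leq_addr |].
  rewrite map_iii hx.
  by have [] := inH_isotropic (laurentX_neq0 E) (lift_iso E g L f h hf iP).
split; [split; by auto | split; by auto |].
move=> D1.
have D1K (K : fieldType) (f : {rmorphism F -> K}) : inD (map_mx f P) 1.
  case: D1 => _ [e qe]; split; first exact: oner_neq0.
  by exists (map_mx f e); rewrite qf_map qe rmorph1.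
(* Here 1 in D(p) enters: it gives the inclusion of D(p) in H(p) over every extension. *)
have ii_iv : cond_ii -> cond_iv.
  by move=> cii K f a Da; apply: cii; apply: inD_inH.
(* Being isotropic over E((t)), p is universal there and represents t. *)
have iv_met : cond_iv -> isotropic_metabolic.
  move=> civ E g iP; apply: inG_met; apply: civ; split; first exact: laurentX_neq0.
  apply: isotropic_universal; [|exact: nmap | exact: iso_laurent].
  exact: (two _ (laurentC E \o g : {rmorphism F -> _})).
have iv_v : cond_iv -> cond_v.
  move=> civ L f x lx M g ff; have x0 := laurent_var_neq0 lx.
  apply: ii_hyp => //; apply: civ.
  apply: isotropic_inD; [exact: (two _ (g \o f : {rmorphism F -> M}))
    | exact: nmap | by rewrite fmorph_eq0 |].
  rewrite -map_v; apply: function_field_isotropic ff;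
    [exact: (two _ f) | by rewrite addn1 (leq_trans m2) |].
  by apply: nondeg_oplus; [exact: nmap | apply: nondeg_scalar1; rewrite oppr_eq0].
have v_met : cond_v -> isotropic_metabolic.
  move=> cv E g iP; have [L [f [x [h [lx hx hf]]]]] := laurent_subfield g.
  have x0 := laurent_var_neq0 lx; apply: (lift_met E g L f x h hx hf).
  apply: function_field_metabolic (cv L f x lx) _;
    [exact: (two _ f) | | exact: nscaled | by rewrite addn1 (leq_trans m2) |].
    by apply: nondeg_oplus; [exact: nmap | apply: nondeg_scalar1; rewrite oppr_eq0].
  rewrite map_v; have [v [v0 qv]] := lift_iso E g L f h hf iP.
  exists (row_mx v 0); split; last by rewrite qf_oplus qv add0r /qf !mul0mx mxE.
  by apply: contraNneq v0 => /(congr1 lsubmx); rewrite row_mxKl linear0 => ->.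
by split; split; auto.
Qed.
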